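(* Let $\mathcal R$ be a primitive, recognizable, prototile-regular, 1-dimensional fusion of constant length. If the fusion is coincident with finite waiting, and if the transition matrices $M_{n-1,n}$ are uniformly bounded, then $X_{\mathcal R}$ is uniquely ergodic and has pure point spectrum.
   Context: Setting (dimension 1, $G=\mathbb R$). $\mathcal P_0$ is a finite set of prototiles (labelled closed intervals); tiles are translates of prototiles; patches are finite concatenations of tiles. A fusion rule is $\mathcal R=\{\mathcal P_n\}_{n\ge0}$, with $\mathcal P_n=\{P_n(1),\ldots,P_n(j_n)\}$ a finite set of patches ($n$-supertiles), each $P_n(j)$ ($n\ge1$) being a concatenation of translates of $(n-1)$-supertiles (a decomposition is fixed). $X_{\mathcal R}$ is the set of tilings of $\mathbb R$ all of whose patches occur, up to translation, in some $P_n(j)$ (assumed nonempty); $X^k_{\mathcal R}$ is defined the same way using the $k$-supertiles as prototiles and the levels $n\ge k$. Topology: tilings are close if, after small translations, they agree exactly on a large ball about $0$; $\mathbb R$ acts by translation. $M_{n-1,n}(k,l)$ is the number of $(n-1)$-supertiles of type $k$ in $P_n(l)$; $M_{n,N}=M_{n,n+1}\cdots M_{N-1,N}$. Uniformly bounded: there is $C$ with $M_{n-1,n}(i,j)\le C$ for all $n,i,j$. Primitive: for each $n$ there is $N$ with all entries of $M_{n,N}$ positive. Recognizable: for each $n\ge1$ the subdivision map $\sigma_n:X^n_{\mathcal R}\to X^{n-1}_{\mathcal R}$ (decomposing each $n$-supertile into $(n-1)$-supertiles) is a homeomorphism. Prototile-regular: the number $j_n$ of $n$-supertiles is the same for all $n$.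 Constant length: for each $n$, all $n$-supertiles have the same length. Coincident with finite waiting: there is a fixed integer $k$ such that for every $n$, any two $(n+k)$-supertiles agree on at least one $n$-supertile (i.e. they have an $n$-supertile of the same type at the same position). Uniquely ergodic: there is exactly one translation-invariant Borel probability measure $\mu$. Pure point spectrum: the span of the measurable eigenfunctions (measurable $f:X_{\mathcal R}\to S^1$ with, for some $\alpha\in\mathbb R$, $f(\mathbf T-v)=e^{2\pi i\alpha v}f(\mathbf T)$) is dense in $L^2(X_{\mathcal R},\mu)$. *)

(* Defs.v *)
From HB Require Import structures.
From mathcomp Require Import all_boot all_order all_algebra.
From mathcomp Require Import all_classical all_reals all_analysis.
From mathcomp Require Import complex.

Set Implicit Arguments.
Unset Strict Implicit.
Unset Printing Implicit Defensive.

Import Order.TTheory GRing.Theory Num.Theory.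
Import numFieldNormedType.Exports.

Local Open Scope classical_set_scope.
Local Open Scope ring_scope.

Section Tilings.
Context {R : realType} {J : Type}.

(* The tile [(x, i)] is the translate of the prototile of type [i] whose left
   endpoint is [x]; [len i] is the length of that prototile. *)
Definition tile : Type := (R * J)%type.

Implicit Types (len : J -> R) (S T : set tile) (w : seq J).

Definition tile_support len (t : tile) : set R :=
  [set y | t.1 <= y <= t.1 + len t.2].

(* [T + v] *)
Definition translate (v : R) T : set tile := [set t | T (t.1 - v, t.2)].

(* The concatenation of tiles of types [w], from left to right, starting
   at [x]. *)
Fixpoint tile_patch len (x : R) w : set tile :=
  if w is i :: w' then (x, i) |` tile_patch len (x + len i) w' else set0.

Definition is_tiling len T : Prop :=
  \bigcup_(t in T) tile_support len t = setT /\
  trivIset T (fun t => (tile_support len t)^°).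

Definition agree_on_ball len (r : R) S T : Prop :=
  forall t, tile_support len t `&` [set y | `|y| <= r] !=set0 -> (S t <-> T t).

Definition tilings_close len (eps : R) S T : Prop :=
  exists u v, [/\ `|u| <= eps, `|v| <= eps &
    agree_on_ball len eps^-1 (translate u S) (translate v T)].

Lemma tilings_closeS len (e e' : R) S T : 0 < e -> e <= e' ->
  tilings_close len e S T -> tilings_close len e' S T.
Proof.
move=> e0 ee' [u [v [ue ve agr]]]; exists u, v; split.
- exact: le_trans ue ee'.
- exact: le_trans ve ee'.
- move=> t [y [ty yr]]; apply: agr; exists y; split => //=.
  by apply: le_trans yr _; rewrite lef_pV2 ?posrE// (lt_le_trans e0).
Qed.

Lemma translateD (u v : R) T :
  translate u (translate v T) = translate (u + v) T.
Proof. by apply/seteqP; split => t; rewrite /translate /= opprD addrA. Qed.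

Lemma translate0 T : translate 0 T = T.
Proof. by apply/seteqP; split => -[x i]; rewrite /translate /= subr0. Qed.

Lemma translateS (v : R) S T : S `<=` T -> translate v S `<=` translate v T.
Proof. by move=> ST t; exact: ST. Qed.

Lemma translate_tile_patch len (v x : R) w :
  translate v (tile_patch len x w) = tile_patch len (x + v) w.
Proof.
elim: w x => [//|i w IH] x /=.
rewrite addrAC -IH; apply/seteqP; split => -[y j] /= [].
- by case=> <- ->; left; rewrite subrK.
- by right.
- by case=> -> ->; left; rewrite addrK.
- by right.
Qed.

Lemma tile_support_translate len (v : R) (t : tile) :
  tile_support len (t.1 + v, t.2) = +%R^~ (- v) @^-1` tile_support len t.
Proof.
by apply/seteqP; split => y; rewrite /tile_support /= lerBrDr lerBlDr addrAC.
Qed.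

Lemma interior_tile_support_translate len (v : R) (t : tile) (y : R) :
  (tile_support len (t.1 + v, t.2))^° y -> (tile_support len t)^° (y - v).
Proof.
rewrite tile_support_translate /interior => H.
have c : {for y - v, continuous (+%R^~ v : R -> R)}.
  by apply: continuousD; [exact: cvg_id | exact: cvg_cst].
have : \forall z \near y - v, (+%R^~ (- v) @^-1` tile_support len t) (z + v).
  by apply: c; rewrite /= subrK.
by apply: filterS => z /=; rewrite addrK.
Qed.

Lemma is_tiling_translate len (v : R) T :
  is_tiling len T -> is_tiling len (translate v T).
Proof.
move=> [cov dis]; split.
  apply/seteqP; split => // y _.
  have : (\bigcup_(t in T) tile_support len t) (y - v) by rewrite cov.
  case=> t Tt ty; exists (t.1 + v, t.2).
    by rewrite /translate /= addrK; case: (t) Tt.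
  by rewrite tile_support_translate.
move=> t t' Tt Tt' [y [ty t'y]].
have E s : s = ((s.1 - v, s.2).1 + v, (s.1 - v, s.2).2) :> tile.
  by rewrite /= subrK; case: s.
rewrite (E t) (E t'); congr (_ + _, _); rewrite ?E.
- congr fst; apply: dis => //; exists (y - v).
  by split; apply: interior_tile_support_translate; rewrite -E.
- congr snd; apply: dis => //; exists (y - v).
  by split; apply: interior_tile_support_translate; rewrite -E.
Qed.

End Tilings.
Arguments tile : clear implicits.

(* A one-dimensional fusion rule. The types of [n]-supertiles are indexed by
   ['I_(ntypes n)], and [decomp n j] lists, from left to right, the types of
   the [n]-supertiles of which the [n.+1]-supertile of type [j] is the
   concatenation; [0]-supertiles are the prototiles. *)
Record fusion_rule (R : realType) := FusionRule {
  ntypes : nat -> nat;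
  proto_len : 'I_(ntypes 0) -> R;
  proto_len_gt0 : forall i, 0 < proto_len i;
  decomp : forall n, 'I_(ntypes n.+1) -> seq 'I_(ntypes n);
  decomp_nonempty : forall n j, decomp (n := n) j != [::]
}.

Section FusionRule.
Context {R : realType} (F : fusion_rule R).

Fixpoint st_len (n : nat) : 'I_(ntypes F n) -> R :=
  match n return 'I_(ntypes F n) -> R with
  | 0 => @proto_len R F
  | n'.+1 => fun j => \sum_(i <- decomp j) st_len i
  end.

(* The [(m + k)]-supertile of type [j] as a word of [k]-supertile types. *)
Fixpoint expand (k m : nat) : 'I_(ntypes F (m + k)) -> seq 'I_(ntypes F k) :=
  match m return 'I_(ntypes F (m + k)) -> seq 'I_(ntypes F k) with
  | 0 => fun j => [:: j]
  | m'.+1 => fun j =>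
      flatten [seq expand i | i <- decomp (j : 'I_(ntypes F (m' + k).+1))]
  end.

(* The [(m + k)]-supertile of type [j] as a patch of [k]-supertiles. *)
Definition supertile (k m : nat) (j : 'I_(ntypes F (m + k))) :
    set (tile R 'I_(ntypes F k)) :=
  tile_patch (@st_len k) 0 (expand j).

Definition admissible (k : nat) (T : set (tile R 'I_(ntypes F k))) : Prop :=
  forall x w, tile_patch (@st_len k) x w `<=` T ->
  exists m (j : 'I_(ntypes F (m + k))) v,
    translate v (tile_patch (@st_len k) x w) `<=` supertile j.

Record hull (k : nat) := Hull {
  hull_tiles :> set (tile R 'I_(ntypes F k));
  hull_tiling : is_tiling (@st_len k) hull_tiles;
  hull_admissible : admissible hull_tiles
}.

HB.instance Definition _ k := gen_eqMixin (hull k).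
HB.instance Definition _ k := gen_choiceMixin (hull k).

(* A set of tilings is open when it contains, with each of its points, all the
   tilings close enough to it. *)
Definition hull_open k (A : set (hull k)) : Prop :=
  forall T, A T -> exists2 eps : R, 0 < eps &
    forall S : hull k, tilings_close (@st_len k) eps T S -> A S.

Lemma hull_openT k : hull_open [set: hull k].
Proof. by move=> T _; exists 1. Qed.

Lemma hull_openI k : setI_closed (@hull_open k).
Proof.
move=> A B oA oB T [/oA[e e0 eA] /oB[d d0 dB]].
have m0 : 0 < Num.min e d by rewrite lt_min e0 d0.
exists (Num.min e d) => // S TS; split.
  by apply: eA; apply: tilings_closeS TS; rewrite // ge_min lexx.
by apply: dB; apply: tilings_closeS TS; rewrite // ge_min lexx orbT.
Qed.

Lemma hull_open_bigU k (I : Type) (f : I -> set (hull k)) :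
  (forall i, hull_open (f i)) -> hull_open (\bigcup_i f i).
Proof.
by move=> fo T [i _ /fo[e e0 ef]]; exists e => // S /ef; exists i.
Qed.

HB.instance Definition _ k := isOpenTopological.Build (hull k)
  (@hull_openT k) (@hull_openI k) (@hull_open_bigU k).

Lemma admissible_translate k (v : R) (T : set (tile R 'I_(ntypes F k))) :
  admissible T -> admissible (translate v T).
Proof.
move=> aT x w xw; have [|m [j [u uj]]] := aT (x - v) w.
  rewrite -translate_tile_patch -[T]translate0 -(addNr v) -translateD.
  exact: translateS.
exists m, j, (u - v).
by move: uj; rewrite !translate_tile_patch addrAC addrA.
Qed.

Definition hull_shift k (v : R) (T : hull k) : hull k :=
  Hull (is_tiling_translate v (hull_tiling T))
       (@admissible_translate k v T (hull_admissible (h := T))).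

Definition subdivide n (T : set (tile R 'I_(ntypes F n.+1))) :
    set (tile R 'I_(ntypes F n)) :=
  \bigcup_(t in T) tile_patch (@st_len n) t.1 (decomp t.2).

Definition transition n : 'M[nat]_(ntypes F n, ntypes F n.+1) :=
  \matrix_(i, j) count_mem i (decomp j).

(* [transition_prod n m] is M_{n, n + m}. *)
Fixpoint transition_prod (n m : nat) : 'M[nat]_(ntypes F n, ntypes F (m + n)) :=
  match m return 'M[nat]_(ntypes F n, ntypes F (m + n)) with
  | 0 => 1%:M
  | m'.+1 => transition_prod n m' *m transition (m' + n)
  end.

Definition bounded_transitions : Prop :=
  exists C : nat, forall n i j, (transition n i j <= C)%N.

Definition primitive_fusion : Prop :=
  forall n, exists2 m, (0 < m)%N &
    forall i j, (0 < transition_prod n m i j)%N.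

(* The subdivision map is the map [s] determined by the first clause, and [g]
   is its inverse. *)
Definition recognizable : Prop :=
  forall n, exists (s : hull n.+1 -> hull n) (g : hull n -> hull n.+1),
    [/\ (forall T, hull_tiles (s T) = subdivide T),
        cancel s g, cancel g s, continuous s & continuous g].

Definition prototile_regular : Prop :=
  forall n, ntypes F n = ntypes F 0.

Definition constant_length : Prop :=
  forall n (i j : 'I_(ntypes F n)), st_len i = st_len j.

Definition coincident_finite_waiting : Prop :=
  exists k : nat, forall n (i j : 'I_(ntypes F (k + n))),
    supertile i `&` supertile j !=set0.

End FusionRule.

Record fusion (R : realType) := Fusion {
  fusion_rule_of :> fusion_rule R;
  fusion_nonempty : [set: hull fusion_rule_of 0] !=set0
}.

Definition tiling_space (R : realType) (F : fusion R) : Type := hull F 0.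

HB.instance Definition _ (R : realType) (F : fusion R) :=
  Topological.copy (tiling_space F) (hull F 0).
HB.instance Definition _ (R : realType) (F : fusion R) :=
  isPointed.Build (tiling_space F) (projT1 (cid (fusion_nonempty F))).

Notation borel_tiling_space F := (g_sigma_algebraType (@open (tiling_space F))).

Section Spectrum.
Context {R : realType} {F : fusion R}.
Local Notation X := (borel_tiling_space F).
Local Notation C := (R[i]).

Definition translation_invariant (mu : probability X R) : Prop :=
  forall (v : R) (A : set X), measurable A -> mu (hull_shift v @^-1` A) = mu A.

Definition cmeasurable (f : X -> C) : Prop :=
  measurable_fun setT (fun T => complex.Re (f T)) /\
  measurable_fun setT (fun T => complex.Im (f T)).

Definition eigenfunction (f : X -> C) : Prop :=
  [/\ cmeasurable f, (forall T, Normc.normc (f T) = 1) &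
      exists alpha : R, forall (T : X) (v : R),
        f (hull_shift (- v) T) =
        Complex (cos (2 * pi * alpha * v)) (sin (2 * pi * alpha * v)) * f T].

Definition cLnorm2 (mu : probability X R) (f : X -> C) : \bar R :=
  Lnorm mu 2%:E (fun T => (Normc.normc (f T))%:E).

Definition pure_point_spectrum (mu : probability X R) : Prop :=
  forall g : X -> C, cmeasurable g -> (cLnorm2 mu g < +oo)%E ->
  forall eps : R, 0 < eps ->
  exists (n : nat) (c : 'I_n -> C) (f : 'I_n -> X -> C),
    (forall i, eigenfunction (f i)) /\
    (cLnorm2 mu (fun T => g T - \sum_(i < n) c i * f i T)%R < eps%:E)%E.

End Spectrum.

Definition uniquely_ergodic (R : realType) (F : fusion R) : Prop :=
  exists mu : probability (borel_tiling_space F) R,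
    translation_invariant mu /\
    forall nu : probability (borel_tiling_space F) R,
      translation_invariant nu -> forall A, measurable A -> nu A = mu A.

(* Main.v *)
From HB Require Import structures.
From mathcomp Require Import all_boot all_order all_algebra.
From mathcomp Require Import all_classical all_reals all_analysis.
From mathcomp Require Import measurable_realfun complex.
From mathcomp Require Import ring lra zify.
Require Import Defs.

Set Implicit Arguments.
Unset Strict Implicit.
Unset Printing Implicit Defensive.

Import Order.TTheory GRing.Theory Num.Theory.
Import numFieldNormedType.Exports.

Local Open Scope classical_set_scope.
Local Open Scope ring_scope.

(** Write [l_N] for the common length of the [N]-supertiles and [Q_N] for the
number of prototiles in each of them; by constant length all prototiles are
equally long too. By recognizability every tiling [T] of the hull is cut into
[N]-supertiles in a continuous, translation equivariant way, and the place of
the origin in its [N]-supertile is a phase [p_N(T)] between [0] and [l_N]. The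
functions [exp (2 i pi q p_N / l_N)] are eigenfunctions, and the proof consists
in showing that these phases determine almost everything about the tiling.

Fix a position in the [N]-supertiles and call it coincident if all the types of
[N]-supertiles have the same prototile there. Two [(k + n)]-supertiles consist
of at most [(J C)^k] supertiles of level [n] each, where [J] is the number of
types and [C] bounds the transition matrices, and on one of these they agree;
so passing from [n] to [k + n] multiplies the largest proportion of positions on
which two types disagree by at most [1 - (J C)^-k]. That proportion therefore
tends to [0] ([mismatches_density]); as there are [J] types at each level,
comparing all of them with a single one shows that the proportion of positions
that are not coincident tends to [0] as well ([window_coincident_small]).

Let [mu] be an invariant measure of finite mass. By invariance the origin is
equally likely to be at each of the [Q_N] prototiles of its supertile, so
outside a set of small measure the prototile at a given distance from the origin
is a function of [p_N] ([measure_bad_small]). The real trigonometric polynomials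
in the phases form an algebra, and the sets whose indicator functions are limits
in mean square of members of such an algebra form a sigma-algebra. It contains
the sets [p_N < x], hence the events that a given prototile occurs at a given
place, hence all Borel sets ([approx_set_all]); this is pure point spectrum.

An invariant probability integrates every nonconstant harmonic to [0], because
translation by half a period changes its sign. Two invariant probabilities thus
agree on trigonometric polynomials, and approximating the indicator of a Borel
set in the mean square for their sum shows that they are equal
([invariant_unique]).

Existence uses the same coincidences to rebuild a tiling from its phases. The
positions of the origin in the supertiles of all the levels form a point of an
odometer, which a uniform number of the unit interval parametrizes; almost
surely each prototile of the tiling is at a coincident position of some level,
so that the position determines it. Together with an independent uniform phase
at level [0] this gives a random tiling ([trace_hull]). Its law is invariant
because the number of times that a pattern matches inside a window of [Q_N]
positions changes by at most one when the pattern is moved by one position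
([stationary], [exists_invariant]). *)

(** * Tilings of the line by intervals of one length *)

Section Lattice.
Context {R : realType} {J : Type} (len : J -> R) (l : R).
Hypotheses (l_gt0 : 0 < l) (len_l : forall i, len i = l).
Implicit Types (T : set (tile R J)).

Lemma interior_tile (x z : R) (i : J) :
  x < z < x + l -> (tile_support len (x, i))^° z.
Proof.
move=> /andP[xz zx].
have : (`]x, x + l[%classic : set R) `<=` tile_support len (x, i).
  by move=> y /=; rewrite in_itv /= /tile_support /= len_l =>
    /andP[/ltW -> /ltW].
move/(@interiorS R); apply; rewrite interior_itv_bnd //=.
by rewrite in_itv /= xz zx.
Qed.

(** Two tiles of length [l] whose left endpoints are less than [l] apart have
the midpoint of their overlap in both interiors. *)
Lemma tile_sep T x i y j : is_tiling len T ->
  T (x, i) -> T (y, j) -> `|x - y| < l -> (x, i) = (y, j).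
Proof.
have l0 := l_gt0.
move=> [_ dis] Tx Ty xy; apply: dis => //.
exists ((x + y + l) / 2); split; apply: interior_tile;
  move: xy; rewrite ltr_norml => /andP[? ?]; apply/andP; split; lra.
Qed.

Lemma tile_sep_eq T x i y j : is_tiling len T ->
  T (x, i) -> T (y, j) -> x - l < y -> y < x + l -> x = y.
Proof.
have l0 := l_gt0.
move=> tT Tx Ty xy yx.
have h : `|x - y| < l by rewrite ltr_norml; apply/andP; split; lra.
by case: (tile_sep tT Tx Ty h).
Qed.

Lemma tile_cover T : is_tiling len T -> forall y, exists x i,
  T (x, i) /\ x <= y <= x + l.
Proof.
move=> [cov _] y.
have : [set: R] y by [].
rewrite -cov => -[[x i] Txi]; rewrite /tile_support /= len_l => ?.
by exists x, i.
Qed.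

(** A tile covers the point half a length beyond the right end of the given one.
If it did not start exactly at that end there would be a gap shorter than [l],
and the tile that covers the middle of the gap would overlap a neighbour. *)
Lemma tile_next T x i : is_tiling len T -> T (x, i) -> exists j, T (x + l, j).
Proof.
have l0 := l_gt0.
move=> tT Tx.
have [y [j [Ty /andP[y1 y2]]]] := tile_cover tT (x + l + l / 2).
have xy : x + l <= y.
  rewrite leNgt; apply/negP => yx.
  have : x = y by apply: (tile_sep_eq tT Tx Ty); lra.
  lra.
have [yx|yx] := leP y (x + l).
  by exists j; have -> : x + l = y by lra.
have [z [k [Tz /andP[z1 z2]]]] := tile_cover tT ((x + l + y) / 2).
have [zx|zx] := ltP z (x + l).
  have : x = z by apply: (tile_sep_eq tT Tx Tz); lra.
  lra.
have : y = z by apply: (tile_sep_eq tT Ty Tz); lra.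
  lra.
Qed.

Lemma tile_prev T x i : is_tiling len T -> T (x, i) -> exists j, T (x - l, j).
Proof.
have l0 := l_gt0.
move=> tT Tx.
have [y [j [Ty /andP[y1 y2]]]] := tile_cover tT (x - l / 2).
have xy : y <= x - l.
  rewrite leNgt; apply/negP => yx.
  have : x = y by apply: (tile_sep_eq tT Tx Ty); lra.
  lra.
have [k Tk] := tile_next tT Ty.
have e : x = y + l by apply: (tile_sep_eq tT Tx Tk); lra.
by exists j; rewrite e addrK.
Qed.

Lemma tile_shift T x i : is_tiling len T -> T (x, i) ->
  forall d : int, exists j, T (x + d%:~R * l, j).
Proof.
move=> tT Tx; elim/int_rect => [|n [j Tj]|n [j Tj]].
- by exists i; rewrite mul0r addr0.
- have [k Tk] := tile_next tT Tj; exists k.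
  by rewrite -addn1 PoszD intrD mulrDl mul1r addrA.
- have [k Tk] := tile_prev tT Tj; exists k.
  by rewrite -addn1 PoszD opprD intrD mulrDl mulN1r addrA.
Qed.

Lemma floor_mod (y : R) :
  0 <= y - (Num.floor (y / l))%:~R * l < l.
Proof.
have l0 := l_gt0.
have /andP[h1 h2] := floor_itv (y / l).
move: h1 h2; rewrite ler_pdivlMr// ltr_pdivrMr// intrD => h1 h2.
by apply/andP; split; lra.
Qed.

Lemma tile_lattice T x i y j : is_tiling len T -> T (x, i) -> T (y, j) ->
  exists d : int, y = x + d%:~R * l.
Proof.
have l0 := l_gt0.
move=> tT Tx Ty; exists (Num.floor ((y - x) / l)).
have [k Tk] := tile_shift tT Tx (Num.floor ((y - x) / l)).
have /andP[h1 h2] := floor_mod (y - x).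
by apply: (tile_sep_eq tT Ty Tk); lra.
Qed.

Lemma tiling_phase T : is_tiling len T -> exists p,
  (0 <= p < l) /\ exists j, T (- p, j).
Proof.
move=> tT; have [x [i [Tx _]]] := tile_cover tT 0.
have [j Tj] := tile_shift tT Tx (Num.floor (- x / l)).
exists (- x - (Num.floor (- x / l))%:~R * l); split; first exact: floor_mod.
by exists j; rewrite opprB addrC opprK.
Qed.

(** The distance from the left end of the tile that contains the origin to the
origin; the origin belongs to the right one of two tiles that share it. *)
Definition phase T : R := xget 0 [set p | 0 <= p < l /\ exists j, T (- p, j)].

(** Cells are numbered from the tile that contains the origin, which is cell
[0]. *)
Definition cell T (d : int) (j : J) : Prop := T (- phase T + d%:~R * l, j).

Lemma phaseP T : is_tiling len T ->
  (0 <= phase T < l) /\ exists j, T (- phase T, j).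
Proof.
move=> /tiling_phase[p pP]; rewrite /phase; case: xgetP => [q -> //|].
by move=> /(_ p).
Qed.

Lemma phase_eq T p j : is_tiling len T -> T (- p, j) -> 0 <= p < l ->
  phase T = p.
Proof.
have l0 := l_gt0.
move=> tT Tp pl; have [ql [k Tk]] := phaseP tT.
by apply: oppr_inj; apply/esym/(tile_sep_eq tT Tp Tk); lra.
Qed.

Lemma phase_tile T x j : is_tiling len T -> T (x, j) ->
  exists d : int, x = - phase T + d%:~R * l.
Proof. by move=> tT Tx; have [_ [k Tk]] := phaseP tT;
  exact: (tile_lattice tT Tk Tx). Qed.

Lemma cell_ex T d : is_tiling len T -> exists j, cell T d j.
Proof. by move=> tT; have [_ [k Tk]] := phaseP tT;
  exact: (tile_shift tT Tk). Qed.

Lemma cell_uniq T d i j : is_tiling len T -> cell T d i -> cell T d j -> i = j.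
Proof.
move=> tT ci cj; have h (x : R) : `|x - x| < l by rewrite subrr normr0.
by case: (tile_sep tT ci cj (h _)).
Qed.

(** The converse of the structure found above, by which tilings are built from
bi-infinite sequences of types. *)
Lemma lattice_tiling (p : R) (t : int -> J) :
  is_tiling len [set u | exists d : int, u = (- p + d%:~R * l, t d)].
Proof.
have l0 := l_gt0.
split.
  apply/seteqP; split => // y _.
  exists (- p + (Num.floor ((y + p) / l))%:~R * l, t (Num.floor ((y + p) / l))).
    by eexists.
  by rewrite /tile_support /= len_l; have := floor_mod (y + p) => ?; lra.
move=> _ _ [d ->] [e ->] [y [yd ye]].
suff -> : d = e by [].
have inI x i : (tile_support len (x, i))^° y -> x < y < x + l.
  have -> : tile_support len (x, i) = `[x, x + l]%classic.
    by apply/seteqP; split => z; rewrite /tile_support /= in_itv /= len_l.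
  by rewrite interior_itv_bnd //= in_itv.
move: yd ye => /inI h1 /inI h2.
have a : (d - e)%:~R < 1%:~R :> R.
  by rewrite -(ltr_pM2r l0) intrB mul1r; lra.
have b : (- 1)%:~R < (d - e)%:~R :> R.
  by rewrite -(ltr_pM2r l0) intrB mulN1r; lra.
by move: a b; rewrite !ltr_int; lia.
Qed.

End Lattice.

(** * Supertiles as words and the density of coincidences *)

Section Words.
Context {A : eqType}.
Implicit Types (u v : seq A).

Definition mismatches u v : nat := count (fun p => p.1 != p.2) (zip u v).

Lemma mismatches_cat u u' v v' : size u = size v ->
  mismatches (u ++ u') (v ++ v') = (mismatches u v + mismatches u' v')%N.
Proof. by move=> uv; rewrite /mismatches zip_cat // count_cat. Qed.

(** Blocks of equal size stay aligned, so that disagreements can be counted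
block by block. *)
Lemma mismatches_flatten (I : Type) (W : I -> seq A) (Q : nat) (a b : seq I) :
  (forall i, size (W i) = Q) -> size a = size b ->
  mismatches (flatten (map W a)) (flatten (map W b)) =
  (\sum_(p <- zip a b) mismatches (W p.1) (W p.2))%N.
Proof.
move=> sW; elim: a b => [|i a IH] [|j b] //=; first by rewrite big_nil.
by move=> [ab]; rewrite big_cons mismatches_cat ?sW // IH.
Qed.

Lemma mismatchesE x0 u v : size u = size v ->
  mismatches u v = (\sum_(s < size u) (nth x0 u s != nth x0 v s))%N.
Proof.
move=> uv; rewrite /mismatches -sum1_count big_mkcond (big_nth (x0, x0)) /=.
rewrite big_mkord size_zip uv minnn; apply: eq_bigr => s _.
by rewrite nth_zip //=; case: eqP.
Qed.

Lemma nth_flatten_uniform (I : Type) (W : I -> seq A) (Q : nat) x0 i0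
    (w : seq I) (e m : nat) : (forall i, size (W i) = Q) ->
  (e < size w)%N -> (m < Q)%N ->
  nth x0 (flatten (map W w)) (e * Q + m) = nth x0 (W (nth i0 w e)) m.
Proof.
move=> sW; elim: w e => [|i w IH] [|e] //= ew mQ; rewrite nth_cat sW.
  by rewrite mul0n add0n mQ.
rewrite mulSn -addnA ltnNge leq_addr /= addKn; exact: IH.
Qed.

Lemma size_flatten_uniform (I : Type) (W : I -> seq A) (Q : nat) (w : seq I) :
  (forall i, size (W i) = Q) -> size (flatten (map W w)) = (size w * Q)%N.
Proof.
by move=> sW; elim: w => //= i w IH; rewrite size_cat IH sW mulSn.
Qed.

End Words.

Section WindowCount.
Implicit Types (f : int -> bool) (Q : nat).

Definition window_count f Q : nat := (\sum_(s < Q) f s)%N.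

(** A shift by one trades the first position of the window for the position
after the last. Counts over long windows are therefore asymptotically shift
invariant, which is the source of the stationarity of the odometer. *)
Lemma window_count_shift1 f Q :
  (window_count (fun s => f (s + 1)%R) Q + f 0 = window_count f Q + f Q)%N.
Proof.
rewrite /window_count; elim: Q => [|Q IH]; first by rewrite !big_ord0.
rewrite !big_ord_recr /= addnAC IH; congr (_ + nat_of_bool (f _))%N.
by rewrite intS addrC.
Qed.

Lemma window_count_shift f Q (d : int) :
  (window_count (fun s => f (s + d)%R) Q <= window_count f Q + `|d|)%N.
Proof.
elim/int_rect: d => [|n IH|n IH].
- by rewrite addn0 leq_eqVlt; apply/orP; left; apply/eqP/eq_bigr => s _;
    rewrite addr0.
- have := window_count_shift1 (fun s => f (s + n)) Q.
  have -> : window_count (fun s => f (s + 1 + n)) Q =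
            window_count (fun s => f (s + n.+1)) Q.
    by apply: eq_bigr => s _; rewrite intS addrA.
  move: IH; case: (f (0 + n)); case: (f (Q%:Z + n)) => /=; lia.
- have := window_count_shift1 (fun s => f (s - n.+1%:Z)) Q.
  have -> : window_count (fun s => f (s + 1 - n.+1%:Z)) Q =
            window_count (fun s => f (s - n%:Z)) Q.
    by apply: eq_bigr => s _; congr (nat_of_bool (f _)); rewrite intS; lia.
  move: IH; case: (f (0 - _)); case: (f (Q%:Z - _)) => /=;
    rewrite ?abszN ?absz_nat; lia.
Qed.

End WindowCount.

Section Fusion.
Context {R : realType} (F : fusion_rule R).
Hypothesis constF : constant_length F.
Variable j0 : forall N, 'I_(ntypes F N).

(** This is [expand] down to prototiles, by recursion on the level itself: the
types of [expand] from level [0] live at level [N + 0], which is not convertible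
to [N]. *)
Fixpoint word (N : nat) : 'I_(ntypes F N) -> seq 'I_(ntypes F 0) :=
  match N return 'I_(ntypes F N) -> seq 'I_(ntypes F 0) with
  | 0 => fun j => [:: j]
  | N'.+1 => fun j => flatten (map (@word N') (decomp j))
  end.

Definition lvl_len N : R := st_len (j0 N).
Definition lvl_size N : nat := size (word (j0 N)).
Definition arity N : nat := size (decomp (j0 N.+1)).

Lemma st_lenE N (j : 'I_(ntypes F N)) : st_len j = lvl_len N.
Proof. exact: constF. Qed.

Lemma st_len_gt0 N (j : 'I_(ntypes F N)) : 0 < st_len j.
Proof.
elim: N j => [|N IH] j /=; first exact: proto_len_gt0.
have := decomp_nonempty j; case: (decomp j) => // i s _.
rewrite big_cons ltr_pwDl //; apply: sumr_ge0 => k _; exact: ltW.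
Qed.

Lemma lvl_len_gt0 N : 0 < lvl_len N. Proof. exact: st_len_gt0. Qed.

Lemma st_len_word N (j : 'I_(ntypes F N)) :
  st_len j = (size (word j))%:R * lvl_len 0.
Proof.
elim: N j => [|N IH] j /=; first by rewrite mul1r -[RHS](st_lenE j).
rewrite size_flatten /shape sumnE -map_comp big_map natr_sum mulr_suml.
by apply: eq_bigr => i _; rewrite IH.
Qed.

Lemma st_len_decomp N (j : 'I_(ntypes F N.+1)) :
  st_len j = (size (decomp j))%:R * lvl_len N.
Proof.
rewrite /= (eq_bigr (fun=> lvl_len N)) => [|i _]; last exact: st_lenE.
by rewrite big_const_seq count_predT iter_addr_0 mulr_natl.
Qed.

Lemma size_word N (j : 'I_(ntypes F N)) : size (word j) = lvl_size N.
Proof.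
apply/eqP; rewrite -(eqr_nat R); apply/eqP/(mulIf (lt0r_neq0 (lvl_len_gt0 0))).
by rewrite -!st_len_word; exact: constF.
Qed.

Lemma size_decomp N (j : 'I_(ntypes F N.+1)) : size (decomp j) = arity N.
Proof.
apply/eqP; rewrite -(eqr_nat R); apply/eqP/(mulIf (lt0r_neq0 (lvl_len_gt0 N))).
by rewrite -!st_len_decomp; exact: constF.
Qed.

Lemma lvl_lenE N : lvl_len N = (lvl_size N)%:R * lvl_len 0.
Proof. exact: st_len_word. Qed.

Lemma lvl_lenS N : lvl_len N.+1 = (arity N)%:R * lvl_len N.
Proof. exact: st_len_decomp. Qed.

Lemma lvl_size0 : lvl_size 0 = 1%N. Proof. by []. Qed.

Lemma lvl_sizeS N : lvl_size N.+1 = (arity N * lvl_size N)%N.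
Proof. by rewrite /lvl_size /= (size_flatten_uniform _ (@size_word N)). Qed.

Lemma arity_gt0 N : (0 < arity N)%N.
Proof. by rewrite lt0n size_eq0 decomp_nonempty. Qed.

Lemma lvl_size_gt0 N : (0 < lvl_size N)%N.
Proof. by elim: N => // N IH; rewrite lvl_sizeS muln_gt0 arity_gt0. Qed.

Lemma lvl_sizeR_gt0 N : 0 < (lvl_size N)%:R :> R.
Proof. by rewrite ltr0n lvl_size_gt0. Qed.

Lemma word_expand n m (j : 'I_(ntypes F (m + n))) :
  word j = flatten (map (@word n) (expand j)).
Proof.
elim: m j => [|m IH] j /=; first by rewrite cats0.
rewrite (eq_map IH); elim: (decomp j) => //= i s ->.
by rewrite map_cat flatten_cat.
Qed.

Lemma size_expand n m (j : 'I_(ntypes F (m + n))) :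
  (size (expand j) * lvl_size n = lvl_size (m + n))%N.
Proof.
by rewrite -(size_word j) word_expand (size_flatten_uniform _ (@size_word n)).
Qed.

Lemma tile_patchP n x (w : seq 'I_(ntypes F n)) y i :
  tile_patch (@st_len R F n) x w (y, i) <->
  exists2 d, (d < size w)%N & y = x + d%:R * lvl_len n /\ nth (j0 n) w d = i.
Proof.
elim: w x => [|a w IH] x /=; first by split => // -[].
have eS d : x + d.+1%:R * lvl_len n = x + lvl_len n + d%:R * lvl_len n.
  by rewrite -natr1 mulrDl mul1r -addrA [lvl_len n + _]addrC.
rewrite st_lenE; split.
- case=> [[-> ->]|/IH[d dw [e1 e2]]]; first by exists 0%N;
  rewrite // mul0r addr0.
  by exists d.+1; rewrite // eS.
- case=> -[_ [-> /= <-]|d dw [e1 e2]]; first by left; rewrite mul0r addr0.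
  by right; apply/IH; exists d => //; rewrite -eS.
Qed.

(** The position is an integer, and there is no coincidence outside of the
supertile, since the places looked at around the origin may lie beyond the
supertile of the origin. *)
Definition coincides N (s : int) (a : 'I_(ntypes F 0)) : bool :=
  if s is Posz m then
    (m < lvl_size N)%N && [forall j : 'I_(ntypes F N), nth (j0 0%N) (word j) m
      == a]
  else false.

Definition coincident N (s : int) : bool := [exists a, coincides N s a].

Section Coincidence.
Variables (J C k : nat).
Hypothesis ntypesJ : forall n, ntypes F n = J.
Hypothesis boundC : forall n i j, (transition F n i j <= C)%N.
Hypothesis coin : forall n (i j : 'I_(ntypes F (k + n))),
  supertile i `&` supertile j !=set0.

(** Each of the [J] types occurs at most [C] times in the decomposition. *)
Lemma arity_le N : (arity N <= J * C)%N.
Proof.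
rewrite /arity -sum1_size -(ntypesJ N).
rewrite (partition_big id xpredT) //=.
apply: (@leq_trans (\sum_(i < ntypes F N) C)); last first.
  by rewrite sum_nat_const card_ord.
apply: leq_sum => i _; have := boundC i (j0 N.+1).
by rewrite mxE -sum1_count.
Qed.

(** Since all the [n]-supertiles have the same length, an [n]-supertile common
to two patches that start at [0] has the same rank in both decompositions. *)
Lemma coin_expand n (i j : 'I_(ntypes F (k + n))) :
  exists2 p, p \in zip (expand i) (expand j) & p.1 = p.2.
Proof.
have [[x a] []] := coin i j.
rewrite /supertile => /tile_patchP[d di [-> ea]] /tile_patchP[e ej [eq eb]].
have {}eq : d = e.
  apply/eqP; rewrite -(eqr_nat R).
  by apply/eqP/(mulIf (lt0r_neq0 (lvl_len_gt0 n)))/(addrI 0).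
have sz : size (expand i) = size (expand j).
  by apply/eqP; rewrite -(eqn_pmul2r (lvl_size_gt0 n)) !size_expand.
exists (nth (j0 n, j0 n) (zip (expand i) (expand j)) d).
  by apply: mem_nth; rewrite size_zip -sz minnn.
by rewrite nth_zip //= ea eq eb.
Qed.

Lemma size_expand_le n m (j : 'I_(ntypes F (m + n))) :
  (size (expand j) <= (J * C) ^ m)%N.
Proof.
elim: m j => [|m IH] j /=; first by rewrite expn0.
rewrite size_flatten /shape sumnE -map_comp big_map expnS.
apply: (@leq_trans (\sum_(i <- decomp j) (J * C) ^ m)).
  by apply: leq_sum => i _; exact: IH.
rewrite big_const_seq count_predT iter_addn_0 mulnC leq_mul2r size_decomp.
by rewrite arity_le orbT.
Qed.

(** The pair of equal [n]-supertiles contributes no disagreement, and each of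
the others contributes at most [b]. *)
Lemma mismatches_step n (b : R) :
  (forall i j : 'I_(ntypes F n), (mismatches (word i) (word j))%:R <= b) ->
  forall i j : 'I_(ntypes F (k + n)),
    (mismatches (word i) (word j))%:R <= (size (expand i)).-1%:R * b.
Proof.
move=> bb i j; rewrite !word_expand.
have sz : size (expand j) = size (expand i).
  by apply/eqP; rewrite -(eqn_pmul2r (lvl_size_gt0 n)) !size_expand.
rewrite (mismatches_flatten (@size_word n)) ?sz //.
have [p pz pp] := coin_expand i j.
rewrite (perm_big _ (perm_to_rem pz)) big_cons pp /=.
have mm0 (u : seq 'I_(ntypes F 0)) : mismatches u u = 0%N.
  by rewrite /mismatches; elim: u => //= a u ->; rewrite eqxx.
rewrite mm0 add0n natr_sum;
  apply: (@le_trans _ _ (\sum_(q <- rem p (zip (expand i) (expand j))) b)).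
  by apply: ler_sum => q _.
by rewrite big_const_seq count_predT iter_addr_0 size_rem // size_zip sz minnn
  mulr_natl.
Qed.

(** The decay is geometric because the number of [n]-supertiles in a
[(k + n)]-supertile is bounded by [(J * C) ^ k] for all [n]. *)
Lemma mismatches_density m : exists N, forall i j : 'I_(ntypes F N),
  (mismatches (word i) (word j))%:R <=
  (1 - ((J * C) ^ k)%:R^-1) ^+ m * (lvl_size N)%:R :> R.
Proof.
elim: m => [|m [N IH]].
  exists 0%N => i j; rewrite expr0 mul1r ler_nat -(size_word i) /mismatches.
  by rewrite (leq_trans (count_size _ _)) // size_zip geq_minl.
exists (k + N)%N => i j; apply: le_trans (mismatches_step IH i j) _.
have q0 : (0 < size (expand i))%N.
  by rewrite -(ltn_pmul2r (lvl_size_gt0 N)) size_expand mul0n lvl_size_gt0.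
rewrite -(size_expand i) natrM mulrCA exprS -!mulrA [X in _ <= X]mulrCA.
rewrite ler_wpM2l //.
  rewrite exprn_ge0 // subr_ge0 invf_le1 ?ler1n ?ltr0n.
    exact: leq_trans q0 (size_expand_le i).
  exact: leq_trans q0 (size_expand_le i).
rewrite !mulrA ler_pM2r ?lvl_sizeR_gt0 // mulrBl mul1r -subn1 natrB // lerD2l
  lerN2.
rewrite mulrC ler_pdivrMr ?mul1r ?ler_nat ?size_expand_le // ltr0n.
exact: leq_trans q0 (size_expand_le i).
Qed.

Lemma mismatches_mono (e : R) N M : (N <= M)%N ->
  (forall i j : 'I_(ntypes F N),
    (mismatches (word i) (word j))%:R <= e * (lvl_size N)%:R :> R) ->
  forall i j : 'I_(ntypes F M),
    (mismatches (word i) (word j))%:R <= e * (lvl_size M)%:R :> R.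
Proof.
move=> NM eN; rewrite -(subnK NM); elim: (M - N)%N => // m IH i j /=.
rewrite (mismatches_flatten (@size_word _)) ?size_decomp // natr_sum.
apply: le_trans (ler_sum _ (fun q _ => IH q.1 q.2)) _.
rewrite big_const_seq count_predT iter_addr_0 size_zip !size_decomp minnn.
by rewrite lvl_sizeS natrM mulrCA mulr_natl.
Qed.

Lemma mismatches_small (e : R) : 0 < e -> exists N0, forall N, (N0 <= N)%N ->
  forall i j : 'I_(ntypes F N),
  (mismatches (word i) (word j))%:R <= e * (lvl_size N)%:R :> R.
Proof.
move=> e0.
have B0 : (0 < (J * C) ^ k)%N.
  have q0 : (0 < size (expand (j0 (k + 0)%N)))%N.
    by rewrite -(ltn_pmul2r (lvl_size_gt0 0)) size_expand mul0n lvl_size_gt0.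
  exact: leq_trans q0 (size_expand_le _).
set c : R := 1 - ((J * C) ^ k)%:R^-1.
have c1 : `|c| < 1.
  rewrite ger0_norm /c; first by rewrite gtrBl invr_gt0 ltr0n.
  by rewrite subr_ge0 invf_le1 ?ler1n ?ltr0n.
have /cvgrPdist_lt/(_ e e0)[m _ mP] := cvg_expr c1.
have [N NP] := mismatches_density m; exists N => M NM;
  apply: mismatches_mono NM _ => i j.
apply: le_trans (NP i j) _; rewrite ler_pM2r ?lvl_sizeR_gt0 //.
have := mP m (leqnn m); rewrite /= sub0r normrN => /ltW.
by apply: le_trans; exact: ler_norm.
Qed.

(** At a position that is not coincident some type differs from the reference
type [j0 N]. *)
Lemma window_coincident N :
  (window_count (fun s => ~~ coincident N s) (lvl_size N) <=
   \sum_(j < ntypes F N) mismatches (word j) (word (j0 N)))%N.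
Proof.
rewrite (eq_bigr (fun j => \sum_(s < lvl_size N)
    (nth (j0 0%N) (word j) s != nth (j0 0%N) (word (j0 N)) s)))%N; last first.
  by move=> j _; rewrite (mismatchesE (j0 0%N)) ?size_word.
rewrite exchange_big /=; apply: leq_sum => s _.
case: (boolP (coincident N s)) => //= nc.
have [/existsP[j jP]|/existsPn nj] := boolP [exists j : 'I_(ntypes F N),
    nth (j0 0%N) (word j) s != nth (j0 0%N) (word (j0 N)) s].
  by rewrite (bigD1 j) //= jP.
case/negP: nc; apply/existsP; exists (nth (j0 0%N) (word (j0 N)) s).
by rewrite /coincides ltn_ord; apply/forallP => j; have := nj j; rewrite negbK.
Qed.

Lemma lvl_size_mono N M : (N <= M)%N -> (lvl_size N <= lvl_size M)%N.
Proof.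
move=> NM; rewrite -(subnK NM); elim: (M - N)%N => // m IH.
by rewrite addSn lvl_sizeS (leq_trans IH) // leq_pmull // arity_gt0.
Qed.

(** The number [J] of types does not depend on the level, so the bound on each
pair of types survives the sum over all of them; the window moved by [d] costs
[`|d|] more, which is negligible for long supertiles. *)
Lemma window_coincident_small (d : int) (e : R) : 0 < e ->
  (forall B, exists N, (B <= lvl_size N)%N) ->
  exists N0, forall N, (N0 <= N)%N ->
    (window_count (fun s => ~~ coincident N (s + d)) (lvl_size N))%:R <=
    e * (lvl_size N)%:R.
Proof.
move=> e0 unb.
have J0 : (0 < J)%N by rewrite -(ntypesJ 0); case: (j0 0%N) => m;
  exact: leq_trans.
have e1 : 0 < e / 2 / J%:R by rewrite !divr_gt0 // ltr0n.
have [N1 N1P] := mismatches_small e1.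
(* Beyond this size [`|d|] is at most [e / 2] times the size. *)
have [N2 N2P] := unb (Num.trunc (`|d|%N%:R / (e / 2))).+1.
exists (maxn N1 N2) => N; rewrite geq_max => /andP[NN1 NN2].
have := leq_trans (window_count_shift _ _ d)
  (leq_add (window_coincident N) (leqnn `|d|)).
rewrite -(ler_nat R) => /le_trans; apply.
rewrite natrD natr_sum [X in _ <= X](_ : _ = e / 2 * (lvl_size N)%:R + e / 2 *
  (lvl_size N)%:R); last first.
  by rewrite -mulrDl -splitr.
apply: lerD.
  apply: le_trans (ler_sum _ (fun j _ => N1P N NN1 j _)) _.
  rewrite sumr_const card_ord ntypesJ -[_ *+ J]mulr_natl mulrA ler_pM2r
    ?lvl_sizeR_gt0 //.
  by rewrite mulrC divfK // pnatr_eq0 -lt0n.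
rewrite mulrC -ler_pdivrMr ?divr_gt0 //.
have /andP[_ /ltW/le_trans] :=
  truncn_itv (x := `|d|%N%:R / (e / 2)) ltac:(by rewrite divr_ge0 // ltW //
    divr_gt0).
apply; rewrite ler_nat; exact: leq_trans N2P (lvl_size_mono NN2).
Qed.

End Coincidence.

(** The form in which the coincidences and the bounds on the transitions enter
the measure theory. *)
Definition mostly_coincident : Prop := forall (d : int) (e : R), 0 < e ->
  exists N,
    (window_count (fun s => ~~ coincident N (s + d)) (lvl_size N))%:R <=
    e * (lvl_size N)%:R.

(** The [N]-supertile of rank [e] in any [(N + 1)]-supertile is of some type,
and all types agree at [s]. *)
Lemma coincides_step N s a e : (e < arity N)%N -> coincides N s a ->
  coincides N.+1 (s + (e * lvl_size N)%N%:Z) a.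
Proof.
case: s => //= m eN /andP[mN /forallP H]; rewrite lvl_sizeS.
apply/andP; split.
  rewrite addnC; apply: (@leq_trans (e.+1 * lvl_size N)).
    by rewrite mulSn addnC ltn_add2r.
  by rewrite leq_mul2r eN orbT.
apply/forallP => j; rewrite addnC (nth_flatten_uniform _ (j0 N) (@size_word N))
  //.
by rewrite size_decomp.
Qed.

Lemma coincides_uniq N s a b : coincides N s a -> coincides N s b -> a = b.
Proof.
case: s => //= m /andP[_ /forallP/(_ (j0 N))/eqP <-].
by move=> /andP[_ /forallP/(_ (j0 N))/eqP].
Qed.

End Fusion.

(** * The supertile hierarchy of a tiling *)

Section HullOpen.
Context {R : realType} (F : fusion_rule R).

Lemma hull_openE n : @open (hull F n) = @hull_open R F n.
Proof. by []. Qed.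

Lemma hull_eq n (S T : hull F n) : hull_tiles S = hull_tiles T -> S = T.
Proof.
case: S T => S s1 s2 [T t1 t2] /= ST; case: T / ST t1 t2 => t1 t2.
by congr Hull; exact: Prop_irrelevance.
Qed.

(** Closeness of tilings moves the tile at [x] by a small amount only, which the
open window tolerates. *)
Lemma open_tile_window n (a b : R) j :
  open [set T : hull F n | exists2 x, a < x < b & hull_tiles T (x, j)].
Proof.
move=> T [x /andP[ax xb] Tx].
(* The ball of radius [e^-1] must reach the left end of the tile even after a
   translation by [e]. *)
pose e := Num.min ((x - a) / 4) (Num.min ((b - x) / 4) (`|x| + 1)^-1).
have x1 : 1 <= `|x| + 1 by rewrite lerDr.
have x0 : 0 < `|x| + 1 by apply: lt_le_trans x1.
have e0 : 0 < e by rewrite !lt_min invr_gt0 x0 !divr_gt0 // subr_gt0.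
exists e => // S [u [v [ue ve agr]]].
have [e1 [e2 e3]] : e <= (x - a) / 4 /\ e <= (b - x) / 4 /\ e <= (`|x| + 1)^-1.
  by rewrite !ge_min !lexx !orbT.
have : translate v S (x + u, j).
  apply/(agr (x + u, j)); last by rewrite /translate /= addrK.
  exists (x + u); split => /=.
    by rewrite /tile_support /= lexx lerDl ltW // st_len_gt0.
  apply: le_trans (ler_normD _ _) _; apply: (@le_trans _ _ (`|x| + 1)).
    rewrite lerD2l (le_trans ue) // (le_trans e3) // invf_le1 //.
  by rewrite -[leLHS]invrK lef_pV2 // posrE // invr_gt0.
rewrite /translate /= => Sx; exists (x + u - v) => //.
move: ue ve; rewrite !ler_norml; lra.
Qed.

Lemma continuous_hull_shift n (v : R) : continuous (@hull_shift R F n v).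
Proof.
apply/continuousP => A; rewrite !hull_openE => oA T AT.
have [e e0 eA] := oA _ AT.
(* The ball for [T] has to contain the ball of radius [e^-1] moved by [v]. *)
exists (e^-1 + `|v|)^-1; first by rewrite invr_gt0 ltr_wpDr ?invr_gt0.
move=> S [u [w [ue we agr]]]; apply: eA; exists u, w.
have le_e : (e^-1 + `|v|)^-1 <= e.
  by rewrite -[leRHS]invrK lef_pV2 ?posrE ?ltr_wpDr ?invr_gt0 // lerDl.
split; [exact: le_trans le_e|exact: le_trans le_e|].
move=> [y i] [z [/= yz ze]].
have := agr (y - v, i); rewrite /translate /= ![y - v - _]addrAC; apply.
exists (z - v); split => /=.
  by move: yz; rewrite /tile_support /=; lra.
by rewrite invrK (le_trans (ler_normB _ _)) // lerD2r.
Qed.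

End HullOpen.

Section Levels.
Context {R : realType} (F : fusion_rule R).
Hypothesis recF : recognizable F.

Lemma translate_subdivide n (v : R) (T : set (tile R 'I_(ntypes F n.+1))) :
  translate v (subdivide T) = subdivide (translate v T).
Proof.
apply/seteqP; split => -[y i].
  case=> -[x j] Tx /=; exists (x + v, j); first by rewrite /translate /= addrK.
  by rewrite /= -translate_tile_patch.
case=> -[x j] Tx /=; rewrite -[x](subrK v) -translate_tile_patch.
by exists (x - v, j).
Qed.

(** [G n T] is the tiling by [n]-supertiles from which [T] is obtained by
repeated subdivision. *)
Definition is_lift (G : forall n, hull F 0 -> hull F n) :=
  [/\ G 0%N = id, (forall n T, hull_tiles (G n T) = subdivide (G n.+1 T)),
      (forall n, continuous (G n)) &
      forall n v T, G n (hull_shift v T) = hull_shift v (G n T)].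

(** The inverses of the subdivision maps are composed. Equivariance is inherited
from subdivision, which commutes with translations and is injective. *)
Lemma supertile_lift : exists G, is_lift G.
Proof.
have gP n : exists g : hull F n -> hull F n.+1,
    [/\ (forall T, hull_tiles T = subdivide (g T)), continuous g &
        forall v T, g (hull_shift v T) = hull_shift v (g T)].
  have [s [g [sE sK gK _ cg]]] := recF n; exists g; split => //.
    by move=> T; rewrite -sE gK.
  move=> v T; rewrite -[RHS]sK; congr g; apply: hull_eq.
  by rewrite sE /= -translate_subdivide -sE gK.
pose g n := projT1 (cid (gP n)).
pose G := nat_rect (fun n => hull F 0 -> hull F n) id (fun n Gn T => g n (Gn
  T)).
have gE n := projT2 (cid (gP n)).
exists G; split => //.
- by move=> n T /=; have [h _ _] := gE n; exact: h.
- elim=> [|n IH]; first by move=> T; exact: cvg_id.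
  by move=> T; apply: continuous_comp;
    [exact: IH|have [_ h _] := gE n; exact: h].
- by elim=> // n IH v T /=; rewrite IH; have [_ _ h] := gE n; exact: h.
Qed.

End Levels.

Section Phases.
Context {R : realType} (F : fusion_rule R).
Hypothesis constF : constant_length F.
Variable j0 : forall N, 'I_(ntypes F N).
Local Notation lvl_len := (lvl_len j0).
Local Notation lvl_size := (lvl_size j0).

Let l_gt0 N : 0 < lvl_len N. Proof. exact: lvl_len_gt0. Qed.
Let len_l N (i : 'I_(ntypes F N)) : st_len i = lvl_len N.
Proof. exact: st_lenE. Qed.

Definition hull_phase n (T : hull F n) : R := phase (lvl_len n) T.

Definition hull_cell (T : hull F 0) (d : int) a : Prop :=
  cell (lvl_len 0) T d a.

Lemma hull_phaseP n (T : hull F n) : (0 <= hull_phase T < lvl_len n) /\ exists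
  j, hull_tiles T (- hull_phase T, j).
Proof. exact (phaseP (l_gt0 n) (@len_l n) (hull_tiling T)). Qed.

Lemma hull_phase_eq n (T : hull F n) p j : hull_tiles T (- p, j) ->
  0 <= p < lvl_len n -> hull_phase T = p.
Proof. exact (phase_eq (l_gt0 n) (@len_l n) (hull_tiling T)). Qed.

Lemma hull_cell_ex T d : exists a, hull_cell T d a.
Proof. exact (cell_ex (l_gt0 0) (@len_l 0) d (hull_tiling T)). Qed.

Lemma hull_cell_uniq T d a b : hull_cell T d a -> hull_cell T d b -> a = b.
Proof. exact (cell_uniq (l_gt0 0) (@len_l 0) (hull_tiling T)). Qed.

Lemma hull_phase_tile n (T : hull F n) x j : hull_tiles T (x, j) ->
  exists d : int, x = - hull_phase T + d%:~R * lvl_len n.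
Proof. exact (phase_tile (l_gt0 n) (@len_l n) (hull_tiling T)). Qed.

Lemma hull_phase_shift n (T : hull F n) v : exists z : int,
  hull_phase (hull_shift (- v) T) = hull_phase T + v + z%:~R * lvl_len n.
Proof.
have [_ [j Tj]] := hull_phaseP T.
have Sj : hull_tiles (hull_shift (- v) T) (- hull_phase T - v, j).
  by rewrite /= /translate /= opprK subrK.
have [d e] := hull_phase_tile Sj; exists d.
have := e; lra.
Qed.

(** A patch of [B] consecutive tiles of a tiling of the hull lies in some
supertile. *)
Lemma lvl_size_unbounded : hull F 0 -> forall B, exists N, (B <= lvl_size N)%N.
Proof.
move=> T B.
have /choice[t tP] : forall d, exists a, hull_cell T d a := hull_cell_ex T.
pose w := mkseq (fun d => t d%:Z) B.
have Tw : tile_patch (@st_len R F 0) (- hull_phase T) w `<=` hull_tiles T.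
  move=> [y i] /(tile_patchP constF j0)[d]; rewrite size_mkseq => dB [-> <-].
  by rewrite nth_mkseq //; exact (tP d%:Z).
have [m [j [v sub]]] := hull_admissible Tw.
exists (m + 0)%N; have := size_expand constF j0 j;
  rewrite lvl_size0 muln1 => <-.
case: B => // B in w Tw sub *.
have inw d : (d < B.+1)%N -> exists2 e, (e < size (expand j))%N &
    - hull_phase T + d%:R * lvl_len 0 + v = e%:R * lvl_len 0.
  move=> dB; have : supertile j (- hull_phase T + d%:R * lvl_len 0 + v, t d).
    apply: sub; change (tile_patch (@st_len R F 0) (- hull_phase T) w
      (- hull_phase T + d%:R * lvl_len 0 + v - v, t d)); rewrite addrK.
    apply/(tile_patchP constF j0); exists d; rewrite ?size_mkseq //.
    by rewrite nth_mkseq.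
  by move=> /(tile_patchP constF j0)[e es [eq _]]; exists e => //;
    rewrite eq add0r.
have [e0 _ q0] := inw 0%N isT.
have [e1 e1s q1] := inw B (ltnSn B).
apply: leq_trans e1s; rewrite ltnS -(ler_nat R) -(ler_pM2r (l_gt0 0)).
have := mulr_ge0 (ler0n R e0) (ltW (l_gt0 0)).
by move: q0 q1; rewrite mul0r addr0 => <- <-; lra.
Qed.

Section WithLift.
Variable G : forall n, hull F 0 -> hull F n.
Hypothesis liftG : is_lift G.

Let G0 : G 0%N = id. Proof. by case: liftG. Qed.
Let GS n T : hull_tiles (G n T) = subdivide (G n.+1 T).
Proof. by case: liftG => _ h _ _; exact: h. Qed.
Let Gcont n : continuous (G n). Proof. by case: liftG => _ _ h _; exact: h. Qed.
Let Gshift n v T : G n (hull_shift v T) = hull_shift v (G n T).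
Proof. by case: liftG => _ _ _ h; exact: h. Qed.

(** Subdividing [n] times a supertile that starts at [x] lays its prototiles
side by side from [x] on. *)
Lemma lift_word n T x j m : hull_tiles (G n T) (x, j) -> (m < lvl_size n)%N ->
  hull_tiles T (x + m%:R * lvl_len 0, nth (j0 0%N) (word j) m).
Proof.
elim: n x j m => [|n IH] x j m.
  by rewrite G0 lvl_size0 ltnS leqn0 => + /eqP ->; rewrite mul0r addr0.
move=> Tj; rewrite (lvl_sizeS constF) => mn.
have w0 := lvl_size_gt0 constF j0 n.
have dn : (m %/ lvl_size n < arity j0 n)%N by rewrite ltn_divLR.
rewrite (divn_eq m (lvl_size n)) /=.
rewrite (nth_flatten_uniform _ (j0 n) (size_word constF j0 (N := n)))
  ?(size_decomp constF j0) ?ltn_mod //.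
rewrite natrD mulrDl natrM -mulrA -(lvl_lenE constF) addrA; apply: IH;
  last by rewrite ltn_mod.
rewrite GS; exists (x, j) => //=; apply/(tile_patchP constF j0).
by exists (m %/ lvl_size n)%N; rewrite ?(size_decomp constF j0).
Qed.

Definition level_phase n T : R := hull_phase (G n T).

(** The rank, in its [n]-supertile, of the prototile that contains the
origin. *)
Definition slot n T : nat := Num.trunc (level_phase n T / lvl_len 0).

(** The [n]-supertile at the origin starts at [- level_phase n T], and the tile
at the origin is one of its prototiles; so the cells of [T] are read off its
word, starting from the slot. *)
Lemma slotP n T : [/\ (slot n T < lvl_size n)%N,
   level_phase n T = (slot n T)%:R * lvl_len 0 + hull_phase T &
   exists j : 'I_(ntypes F n), forall d : int, forall m : nat,
      (m < lvl_size n)%N -> (slot n T)%:Z + d = m ->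
      hull_cell T d (nth (j0 0%N) (word j) m)].
Proof.
have [/andP[p0 pl] [j Tj]] := hull_phaseP (G n T).
have /andP[h1 h2] := truncn_itv (divr_ge0 p0 (ltW (l_gt0 0))).
rewrite -/(slot n T) ler_pdivlMr // in h1.
rewrite ltr_pdivrMr // -natr1 mulrDl mul1r in h2.
have sw : (slot n T < lvl_size n)%N.
  rewrite -(ltr_nat R) -(ltr_pM2r (l_gt0 0)) -(lvl_lenE constF).
  exact: le_lt_trans pl.
have pE : level_phase n T = (slot n T)%:R * lvl_len 0 + hull_phase T.
  have := lift_word Tj sw.
  have -> : - hull_phase (G n T) + (slot n T)%:R * lvl_len 0 =
            - (level_phase n T - (slot n T)%:R * lvl_len 0) by rewrite opprB
              addrC.
  move/hull_phase_eq => ->; first by rewrite addrC subrK.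
  by rewrite /level_phase; apply/andP; split; lra.
split => //; exists j => d m mw e.
have := lift_word Tj mw; rewrite /hull_cell /cell.
have -> // : - hull_phase (G n T) + m%:R * lvl_len 0 =
  - phase (lvl_len 0) T + d%:~R * lvl_len 0.
have -> : m%:R = (slot n T)%:R + d%:~R :> R.
  by rewrite -[RHS](intrD R (slot n T)) e.
by rewrite -/(level_phase n T) pE mulrDl /hull_phase; ring.
Qed.

Lemma level_phase_itv n T : 0 <= level_phase n T < lvl_len n.
Proof. by have [] := hull_phaseP (G n T). Qed.

Lemma coincides_hull_cell n T d a :
  coincides j0 n ((slot n T)%:Z + d) a -> hull_cell T d a.
Proof.
have [_ _ [j H]] := slotP n T.
case e : (_ + d) => [m|//] /= /andP[mw /forallP/(_ j)/eqP <-].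
exact: H e.
Qed.

(** The phase is not continuous, as it jumps from [lvl_len n] to [0] when a tile
boundary passes the origin, but it is lower semicontinuous, which suffices for
measurability. *)
Lemma open_hull_phase_gt n (a : R) : 0 <= a -> open [set T : hull F n | a <
  hull_phase T].
Proof.
move=> a0.
have -> : [set T : hull F n | a < hull_phase T] =
  \bigcup_j [set T | exists2 x, - lvl_len n < x < - a & hull_tiles T (x, j)].
  apply/seteqP; split => T /=.
    have [/andP[p0 pl] [j Tj]] := hull_phaseP T => ap.
    by exists j => //; exists (- hull_phase T) => //; rewrite !ltrN2 pl ap.
  move=> [j _ [x xa Tx]].
  have -> : hull_phase T = - x; last by lra.
  by apply: (hull_phase_eq (j := j)); rewrite ?opprK //; lra.
by apply: bigcup_open => j _; exact: open_tile_window.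
Qed.

Lemma open_level_phase_gt n (a : R) : 0 <= a ->
  open [set T : hull F 0 | a < level_phase n T].
Proof.
move=> a0; move/continuousP: (@Gcont n) => H.
exact: H (open_hull_phase_gt a0).
Qed.

Lemma level_phase_shift n T v : exists z : int,
  level_phase n (hull_shift (- v) T) = level_phase n T + v + z%:~R * lvl_len n.
Proof. by rewrite /level_phase Gshift; exact: hull_phase_shift. Qed.

(** The left end of the [N]-supertile at the origin is also the left end of an
[n]-supertile. *)
Lemma level_phase_refine n N T : (n <= N)%N -> exists d : int,
  level_phase N T = level_phase n T + d%:~R * lvl_len n.
Proof.
have first m x : (exists i, hull_tiles (G (m + n) T) (x, i)) ->
    exists i, hull_tiles (G n T) (x, i).
  elim: m => [//|m IH] [i Ti]; apply: IH.
  exists (nth (j0 _) (decomp i) 0); rewrite GS; exists (x, i) => //.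
  apply/(tile_patchP constF j0); exists 0%N; rewrite ?mul0r ?addr0 //.
  by rewrite lt0n size_eq0 decomp_nonempty.
move=> nN; have [|i Ti] := first (N - n)%N (- level_phase N T).
  by rewrite subnK //; have [] := hull_phaseP (G N T).
have [d e] := hull_phase_tile Ti; exists (- d); move: e.
by rewrite -/(level_phase n T) intrN mulNr; lra.
Qed.

End WithLift.
End Phases.

(** * Mean square approximation by an algebra of bounded functions *)

Section L2Approximation.
Context d (X : measurableType d) (R : realType) (mu : {measure set X -> \bar
  R}).
Hypothesis mu_fin : (mu [set: X] < +oo)%E.

Implicit Types f g u v : X -> R.

Definition sq_integral (f : X -> R) : \bar R := (\int[mu]_x ((f x) ^+ 2)%:E)%E.

Lemma measurable_sq (f : X -> R) : measurable_fun setT f ->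
  measurable_fun setT (fun x => ((f x) ^+ 2)%:E).
Proof. by move=> mf; apply/measurable_EFinP; exact: measurable_funX. Qed.

Lemma sq_integral_ge0 f : (0 <= sq_integral f)%E.
Proof. by apply: integral_ge0 => x _; rewrite lee_fin sqr_ge0. Qed.

Lemma sq_integral_le f g : measurable_fun setT f -> measurable_fun setT g ->
  (forall x, (f x) ^+ 2 <= (g x) ^+ 2) -> (sq_integral f <= sq_integral g)%E.
Proof.
move=> mf mg fg; apply: ge0_le_integral => //; try exact: measurable_sq.
- by move=> x _; rewrite lee_fin sqr_ge0.
- by move=> x _; rewrite lee_fin.
Qed.

Lemma sq_integralZ c f : measurable_fun setT f ->
  sq_integral (fun x => c * f x) = ((c ^+ 2)%:E * sq_integral f)%E.
Proof.
move=> mf; rewrite /sq_integral -ge0_integralZl //.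
- by apply: eq_integral => x _; rewrite exprMn EFinM.
- exact: measurable_sq.
- by move=> x _; rewrite lee_fin sqr_ge0.
- by rewrite lee_fin sqr_ge0.
Qed.

(** From [(f + g) ^+ 2 <= 2 f ^+ 2 + 2 g ^+ 2]. It replaces the triangle
inequality, so that squared distances can be handled without roots. *)
Lemma sq_integralD f g : measurable_fun setT f -> measurable_fun setT g ->
  (sq_integral (fun x => f x + g x)%R <= 2%:E * sq_integral f + 2%:E *
    sq_integral g)%E.
Proof.
move=> mf mg.
have E (h : X -> R) : measurable_fun setT h ->
    (2%:E * sq_integral h = \int[mu]_x (2 * (h x) ^+ 2)%:E)%E.
  move=> mh; rewrite /sq_integral -ge0_integralZl //.
  - exact: measurable_sq.
  - by move=> x _; rewrite lee_fin sqr_ge0.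
have m2 (h : X -> R) : measurable_fun setT h ->
    measurable_fun setT (fun x => (2 * (h x) ^+ 2)%:E).
  move=> mh; apply/measurable_EFinP; apply: measurable_funM => //.
  exact: measurable_funX.
have p2 (h : X -> R) x : (0 <= (2 * (h x) ^+ 2)%:E :> \bar R)%E.
  by rewrite lee_fin mulr_ge0 // sqr_ge0.
rewrite !E // -ge0_integralD //; try exact: m2.
apply: ge0_le_integral => //.
- by move=> x _; rewrite lee_fin sqr_ge0.
- by apply: measurable_sq; exact: measurable_funD.
- by apply: emeasurable_funD; exact: m2.
- move=> x _; rewrite -EFinD lee_fin.
  have := sqr_ge0 (f x - g x); rewrite sqrrB sqrrD; lra.
Qed.

Lemma sq_integral_dominated (f_ : nat -> X -> R) (f G : X -> R) :
  (forall n, measurable_fun setT (f_ n)) -> measurable_fun setT f ->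
  measurable_fun setT G -> (sq_integral G < +oo)%E ->
  (forall n x, (f x - f_ n x) ^+ 2 <= (G x) ^+ 2) ->
  (forall x, f_ ^~ x @ \oo --> f x) ->
  forall e, 0 < e -> exists n, (sq_integral (fun x => f x - f_ n x)%R < e%:E)%E.
Proof.
move=> mf_ mf mG iG fG cf e e0.
have mB n : measurable_fun setT (fun x => f x - f_ n x) by exact:
  measurable_funB.
have h1 : {ae mu, forall x, setT x ->
    (fun n => ((f x - f_ n x) ^+ 2)%:E) @ \oo --> cst (0%:E : \bar R) x}.
  apply: aeW => x _ /=.
  have c1 : (f x - f_ n x) @[n --> \oo] --> (0 : R).
    by rewrite -[X in _ --> X](subrr (f x)); apply: cvgB;
      [exact: cvg_cst|exact: cf].
  have c : (f x - f_ n x) ^+ 2 @[n --> \oo] --> (0 : R).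
    by rewrite -[X in _ --> X](mul0r 0); exact: cvgM.
  by apply/fine_cvgP; split; [exact: nearW|exact: c].
have h2 : mu.-integrable setT (fun x => ((G x) ^+ 2)%:E).
  apply/integrableP; split; first exact: measurable_sq.
  by under eq_integral do rewrite gee0_abs ?lee_fin ?sqr_ge0 //.
have h3 : {ae mu, forall x n, setT x ->
    (`|((f x - f_ n x) ^+ 2)%:E| <= ((G x) ^+ 2)%:E)%E}.
  by apply: aeW => x n _ /=; rewrite lee_fin ger0_norm ?sqr_ge0.
have [_ _] := dominated_convergence measurableT (fun n => measurable_sq (mB n))
  (measurable_cst _) h1 h2 h3.
rewrite integral_cst // mul0e => /fine_cvgP[fin] /cvgrPdist_lt/(_ e e0).
move=> cv; near \oo => n; exists n.
have finn : (sq_integral (fun x => f x - f_ n x) \is a fin_num) by near: n;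
  exact: fin.
rewrite -(fineK finn) lte_fin.
have : `|0 - fine (sq_integral (fun x => f x - f_ n x))| < e by near: n;
  exact: cv.
by rewrite sub0r normrN; apply: le_lt_trans; exact: ler_norm.
Unshelve. all: by end_near. Qed.

Lemma sq_integral_cst c : (sq_integral (cst c) < +oo)%E.
Proof.
by rewrite /sq_integral /= integral_cst //= lte_mul_pinfty // lee_fin sqr_ge0.
Qed.

Definition bounded_algebra (A : set (X -> R)) :=
  [/\ forall c, A (cst c),
      forall u v, A u -> A v -> A (fun x => u x + v x),
      forall u v, A u -> A v -> A (fun x => u x * v x),
      forall u, A u -> measurable_fun setT u &
      forall u, A u -> exists M : R, forall x, `|u x| <= M].

Variable A : set (X -> R).
Hypothesis algA : bounded_algebra A.

Let A_cst c : A (cst c). Proof. by case: algA. Qed.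
Let AD u v : A u -> A v -> A (fun x => u x + v x).
Proof. by case: algA => _ h _ _ _; exact: h. Qed.
Let AM u v : A u -> A v -> A (fun x => u x * v x).
Proof. by case: algA => _ _ h _ _; exact: h. Qed.
Let A_meas u : A u -> measurable_fun setT u.
Proof. by case: algA => _ _ _ h _; exact: h. Qed.
Let A_bnd u : A u -> exists M : R, forall x, `|u x| <= M.
Proof. by case: algA => _ _ _ _ h; exact: h. Qed.

Definition approximable (f : X -> R) := measurable_fun setT f /\
  forall e, 0 < e -> exists2 u,
    A u & (sq_integral (fun x => f x - u x)%R < e%:E)%E.

Lemma A_approximable u : A u -> approximable u.
Proof.
move=> Au; split; first exact: A_meas.
move=> e e0; exists u => //; rewrite /sq_integral.
under eq_integral do rewrite subrr expr0n /=.
by rewrite integral0.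
Qed.

Lemma approximable_lim f : measurable_fun setT f ->
  (forall e, 0 < e -> exists2 g, approximable g &
     (sq_integral (fun x => f x - g x)%R < e%:E)%E) -> approximable f.
Proof.
move=> mf fg; split => // e e0.
have e4 : 0 < e / 4 by rewrite divr_gt0.
have [g [mg gA] fge] := fg _ e4; have [u Au gu] := gA _ e4; exists u => //.
have mu_ := A_meas Au.
have -> : (fun x => f x - u x) = (fun x => (f x - g x) + (g x - u x)).
  by apply/funext => x; rewrite addrA subrK.
apply: le_lt_trans (sq_integralD _ _) _; try exact: measurable_funB.
have -> : e%:E = (2%:E * (e / 4)%:E + 2%:E * (e / 4)%:E)%E.
  by rewrite -!EFinM -EFinD; congr EFin; field.
by apply: lteD; rewrite lte_pmul2l.
Qed.

Lemma approximableD f g : approximable f -> approximable g ->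
  approximable (fun x => f x + g x).
Proof.
move=> [mf fA] [mg gA]; split; first exact: measurable_funD.
move=> e e0; have e4 : 0 < e / 4 by rewrite divr_gt0.
have [u Au fu] := fA _ e4; have [v Av gv] := gA _ e4.
exists (fun x => u x + v x); first exact: AD.
have mu_ := A_meas Au; have mv := A_meas Av.
have -> : (fun x => f x + g x - (u x + v x)) =
          (fun x => (f x - u x) + (g x - v x)).
  by apply/funext => x; rewrite opprD addrACA.
apply: le_lt_trans (sq_integralD _ _) _; try exact: measurable_funB.
have -> : e%:E = (2%:E * (e / 4)%:E + 2%:E * (e / 4)%:E)%E.
  by rewrite -!EFinM -EFinD; congr EFin; field.
by apply: lteD; rewrite lte_pmul2l.
Qed.

Lemma sq_integral_bounded (f g : X -> R) M : measurable_fun setT f ->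
  measurable_fun setT g -> (forall x, `|f x| <= M) ->
  (sq_integral (fun x => f x * g x)%R <= (M ^+ 2)%:E * sq_integral g)%E.
Proof.
move=> mf mg fM; rewrite -sq_integralZ //; apply: sq_integral_le.
- exact: measurable_funM.
- exact: measurable_funM.
- move=> x; rewrite !exprMn ler_wpM2r ?sqr_ge0 // -[leLHS]real_normK ?num_real
  //.
  by rewrite ler_sqr ?nnegrE // (le_trans _ (fM x)).
Qed.

Lemma approximableMA f u : approximable f -> A u ->
  approximable (fun x => u x * f x).
Proof.
move=> [mf fA] Au; split; first by apply: measurable_funM => //; exact: A_meas.
move=> e e0; have [M uM] := A_bnd Au.
have M1 : 0 < M ^+ 2 + 1 by rewrite ltr_wpDl ?sqr_ge0.
have e1 : 0 < e / (M ^+ 2 + 1) by rewrite divr_gt0.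
have [v Av fv] := fA _ e1; exists (fun x => u x * v x); first exact: AM.
have -> : (fun x => u x * f x - u x * v x) = (fun x => u x * (f x - v x)).
  by apply/funext => x; rewrite mulrBr.
have mB : measurable_fun setT (fun x => f x - v x).
  by apply: measurable_funB => //; exact: A_meas.
apply: le_lt_trans (sq_integral_bounded (A_meas Au) mB uM) _.
apply: (@le_lt_trans _ _ ((M ^+ 2 + 1)%:E * sq_integral (fun x => f x - v
  x)%R)%E).
  by rewrite lee_wpmul2r ?sq_integral_ge0 // lee_fin lerDl.
have -> : e%:E = ((M ^+ 2 + 1)%:E * (e / (M ^+ 2 + 1))%:E)%E.
  by rewrite -EFinM mulrCA divff ?mulr1 // gt_eqF.
by rewrite lte_pmul2l.
Qed.

(** The product is approximated in two steps: first [g] by a member [v] of the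
algebra, which needs [f] bounded, and then [f] in the product by [v], which is
bounded. *)
Lemma approximableM f g M : approximable f -> (forall x, `|f x| <= M) ->
  approximable g -> approximable (fun x => f x * g x).
Proof.
move=> fA fM [mg gA]; have mf := fA.1.
apply: approximable_lim; first exact: measurable_funM.
move=> e e0.
have M1 : 0 < M ^+ 2 + 1 by rewrite ltr_wpDl ?sqr_ge0.
have e1 : 0 < e / (M ^+ 2 + 1) by rewrite divr_gt0.
have [v Av gv] := gA _ e1; exists (fun x => v x * f x).
  exact: approximableMA.
have -> : (fun x => f x * g x - v x * f x) = (fun x => f x * (g x - v x)).
  by apply/funext => x; rewrite mulrBr [v x * _]mulrC.
have mB : measurable_fun setT (fun x => g x - v x).
  by apply: measurable_funB => //; exact: A_meas.
apply: le_lt_trans (sq_integral_bounded mf mB fM) _.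
apply: (@le_lt_trans _ _ ((M ^+ 2 + 1)%:E * sq_integral (fun x => g x - v
  x)%R)%E).
  by rewrite lee_wpmul2r ?sq_integral_ge0 // lee_fin lerDl.
have -> : e%:E = ((M ^+ 2 + 1)%:E * (e / (M ^+ 2 + 1))%:E)%E.
  by rewrite -EFinM mulrCA divff ?mulr1 // gt_eqF.
by rewrite lte_pmul2l.
Qed.

Lemma approximable_cvg (f_ : nat -> X -> R) (f G : X -> R) :
  (forall n, approximable (f_ n)) ->
  measurable_fun setT G -> (sq_integral G < +oo)%E ->
  (forall n x, (f x - f_ n x) ^+ 2 <= (G x) ^+ 2) ->
  (forall x, f_ ^~ x @ \oo --> f x) -> approximable f.
Proof.
move=> fA mG iG fG cf.
have mf : measurable_fun setT f.
  by apply: (@measurable_fun_cvg _ _ _ setT f_) => [n|x _];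
    [exact: (fA n).1|exact: cf].
apply: approximable_lim => // e e0.
have mf_ n := (fA n).1.
have [n fn] := sq_integral_dominated mf_ mf mG iG fG cf e0.
by exists (f_ n).
Qed.

Lemma approximableZ c f : approximable f -> approximable (fun x => c * f x).
Proof. by move=> fA; exact: (approximableMA fA (A_cst c)). Qed.

Definition approx_set (E : set X) := measurable E /\ approximable (\1_E).

Lemma indic_le1 (E : set X) x : `|\1_E x| <= 1 :> R.
Proof. by rewrite indicE ger0_norm // lern1; case: (_ \in _). Qed.

Lemma approx_setC E : approx_set E -> approx_set (~` E).
Proof.
move=> [mE aE]; split; first exact: measurableC.
have -> : \1_(~` E) = (fun x => 1 + (-1) * \1_E x) :> (X -> R).
  by apply/funext => x; rewrite !indicE in_setC; case: (x \in E);
    rewrite /= ?mulr1 ?mulr0; ring.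
by apply: approximableD (A_approximable (A_cst 1)) _; exact: approximableZ.
Qed.

Lemma approx_setI E E' : approx_set E -> approx_set E' -> approx_set (E `&` E').
Proof.
move=> [mE aE] [mE' aE']; split; first exact: measurableI.
have -> : \1_(E `&` E') = (fun x => \1_E x * \1_E' x) :> (X -> R).
  by rewrite indicI.
exact: approximableM aE (indic_le1 E) aE'.
Qed.

Lemma approx_setU E E' : approx_set E -> approx_set E' -> approx_set (E `|` E').
Proof.
move=> hE hE'; rewrite -[_ `|` _]setCK setCU.
by apply: approx_setC; apply: approx_setI; exact: approx_setC.
Qed.

Lemma approx_set0 : approx_set set0.
Proof.
by split => //; rewrite indic0; exact: A_approximable (A_cst 0).
Qed.

(** The limit is measurable as the set where its indicator exceeds [1 / 2]. *)
Lemma approx_set_cvg (f_ : nat -> X -> R) E :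
  (forall n, approximable (f_ n)) -> (forall n x, 0 <= f_ n x <= 1) ->
  (forall x, f_ ^~ x @ \oo --> (\1_E x : R)) -> approx_set E.
Proof.
move=> fA f01 cf.
have aE : approximable \1_E.
  apply: (approximable_cvg (G := cst 1) fA _ (sq_integral_cst 1) _ cf) =>
    // n x.
  rewrite /= expr1n -[leLHS]real_normK ?num_real // expr_le1 // ler_norml.
  by have := f01 n x; rewrite indicE; case: (x \in E) => /= ?; lra.
split => //.
have -> : E = setT `&` [set x | (1 / 2 : R) < \1_E x].
  apply/seteqP; split => x /=; rewrite indicE.
    by move=> Ex; rewrite mem_set //=; split => //; lra.
  by case: (boolP (x \in E)) => [/set_mem //|_ [_ /=]]; lra.
have := measurable_fun_ltr (measurable_cst (1 / 2 : R)) aE.1.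
by move/(_ measurableT [set true]); rewrite preimage_true; exact.
Qed.

Lemma approx_set_bigcup (E : (set X)^nat) : (forall n, approx_set (E n)) ->
  approx_set (\bigcup_n E n).
Proof.
move=> hE; pose U n := \bigcup_(i < n) E i.
have hU n : approx_set (U n).
  rewrite /U; elim: n => [|n IH]; first by rewrite bigcup_mkord big_ord0;
    exact: approx_set0.
  by move: IH; rewrite !bigcup_mkord big_ord_recr /= => IH; exact: approx_setU.
apply: (@approx_set_cvg (fun n => \1_(U n))) => [n|n x|x];
  first exact: (hU n).2.
  by rewrite indicE; case: (x \in U n) => /=; lra.
rewrite indicE; have [/set_mem[k _ Ek]|nx] := boolP (x \in _).
  apply: cvg_near_cst; exists k.+1 => // n /= kn; rewrite indicE mem_set //.
  by exists k.
apply: cvg_near_cst; apply: nearW => n; rewrite indicE memNset // => -[k kn Ek].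
by apply: (negP nx); apply/mem_set; exists k.
Qed.

Lemma approx_set_sigma_algebra : sigma_algebra setT approx_set.
Proof.
split; first exact: approx_set0.
- by move=> E hE; rewrite setTD; exact: approx_setC.
- exact: approx_set_bigcup.
Qed.

Lemma AX u n : A u -> A (fun x => u x ^+ n).
Proof.
move=> Au; elim: n => [|n IH]; first exact: A_cst.
have -> : (fun x => u x ^+ n.+1) = (fun x => u x * u x ^+ n).
  by apply/funext => x; rewrite exprS.
exact: AM.
Qed.

Lemma bernoulli_ge (z : R) m : 0 <= z <= 1 -> 1 - m%:R * z <= (1 - z) ^+ m.
Proof.
move=> /andP[z0 z1]; elim: m => [|m IH]; first by rewrite mul0r subr0 expr0.
rewrite exprS; apply: (@le_trans _ _ ((1 - z) * (1 - m%:R * z))).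
  rewrite -natr1; have : 0 <= m%:R * z * z by rewrite !mulr_ge0.
  lra.
by apply: ler_wpM2l => //; rewrite subr_ge0.
Qed.

Lemma bernoulli_le (z : R) m : 0 <= z <= 1 -> (1 - z) ^+ m <= (1 + m%:R * z)^-1.
Proof.
move=> /andP[z0 z1].
have p k : 0 < 1 + k%:R * z by rewrite ltr_wpDr // mulr_ge0.
rewrite -[leRHS]mul1r ler_pdivlMr //; elim: m => [|m IH].
  by rewrite mul0r expr0 addr0 mulr1.
apply: le_trans IH; rewrite exprSr -mulrA; apply: ler_wpM2l.
  by rewrite exprn_ge0 // subr_ge0.
rewrite -natr1; have : 0 <= m%:R * z * z by rewrite !mulr_ge0.
have : 0 <= z * z by rewrite mulr_ge0.
lra.
Qed.

(** With [z = w ^+ 2], the sequence [n w ^+ n] is bounded by [1 / (1 - w)], as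
[n] times the least term of a geometric series. *)
Lemma cvg_natr_expr (z : R) : 0 <= z < 1 -> n%:R * z ^+ n @[n --> \oo] --> (0 :
  R).
Proof.
move=> /andP[z0 z1]; pose w := Num.sqrt z.
have w0 : 0 <= w by exact: sqrtr_ge0.
have w1 : w < 1 by rewrite -[ltRHS]sqrtr1 ltr_sqrt.
have zw : z = w * w by rewrite -expr2 sqr_sqrtr.
have b n : n%:R * w ^+ n * (1 - w) <= 1 - w ^+ n.
  elim: n => [|n IH]; first by rewrite !mul0r expr0 subrr.
  have h1 : 0 <= (1 - w ^+ n.+1) * (1 - w).
    by rewrite mulr_ge0 ?subr_ge0 ?exprn_ile1 // ltW.
  have h2 := ler_wpM2l w0 IH.
  by move: h1 h2; rewrite -natr1 exprS; nra.
have c2 : (1 - w)^-1 * w ^+ n @[n --> \oo] --> (0 : R).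
  rewrite -[X in _ --> X](mulr0 (1 - w)^-1); apply: cvgM; first exact: cvg_cst.
  by apply: cvg_expr; rewrite ger0_norm.
apply: (squeeze_cvgr _ (cvg_cst 0) c2); apply: nearW => n.
have wn : 0 <= w ^+ n by rewrite exprn_ge0.
rewrite mulr_ge0 ?exprn_ge0 //= zw exprMn mulrA ler_wpM2r //.
rewrite -[leRHS]mul1r ler_pdivlMr ?subr_gt0 //.
by apply: le_trans (b n) _; rewrite gerBl.
Qed.

(** These polynomials converge to the indicator of [y < 1 / 2]. By Bernoulli
[(1 - z) ^+ m] is at least [1 - m z] and at most [1 / (1 + m z)]; for
[z = y ^+ n] and [m = n 2 ^ n] the product [m z] is [n (2 y) ^+ n], which tends
to [0] or to infinity according to the side of [1 / 2] on which [y] lies. *)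
Lemma step_approx (y : R) : 0 <= y <= 1 ->
  (1 - y ^+ n) ^+ (n * 2 ^ n) @[n --> \oo] --> ((y < 1 / 2)%R%:R : R).
Proof.
move=> /andP[y0 y1].
have yn n : 0 <= y ^+ n <= 1 by rewrite exprn_ge0 ?exprn_ile1.
have Q0 n : 0 <= 1 - y ^+ n by have := yn n; lra.
have kE n : (n * 2 ^ n)%:R * y ^+ n = n%:R * (2 * y) ^+ n.
  by rewrite natrM natrX exprMn mulrA.
have [yh|yh] := ltP y (1 / 2) => /=.
  have c2 : 1 - n%:R * (2 * y) ^+ n @[n --> \oo] --> (1 : R).
    rewrite -[X in _ --> X](subr0 1); apply: cvgB; first exact: cvg_cst.
    by apply: cvg_natr_expr; lra.
  have c1 : (fun=> 1) @ \oo --> (1 : R) by exact: cvg_cst.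
  apply: (squeeze_cvgr _ c2 c1).
  apply: nearW => n; rewrite -kE bernoulli_ge //= exprn_ile1 // gerBl.
  by have /andP[] := yn n.
apply: (squeeze_cvgr _ (cvg_cst 0) cvg_harmonic).
apply: nearW => n; rewrite exprn_ge0 //=.
apply: le_trans (bernoulli_le _ (yn n)) _.
have e1 : 1 <= (2 * y) ^+ n by rewrite exprn_ege1 //; lra.
have h : n.+1%:R <= 1 + n%:R * (2 * y) ^+ n :> R.
  by rewrite -natr1 addrC lerD2l ler_peMr.
rewrite kE /harmonic lef_pV2 ?posrE //.
exact: lt_le_trans h.
Qed.

(** An affine change of variable maps the values of [u] between [0] and [1] and
the threshold [t] to [1 / 2]; the polynomials of [step_approx] then remain in
the algebra. *)
Lemma approx_set_lt u t : A u -> approx_set [set x | u x < t].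
Proof.
move=> Au; have [M uM] := A_bnd Au.
(* Then [c * (u - t)] has absolute value at most [1 / 2]. *)
pose c : R := (2 * (`|M| + `|t| + 1))^-1.
have c0 : 0 < c.
  by rewrite invr_gt0 mulr_gt0 // ltr_wpDl // addr_ge0.
pose y x := (1 / 2 - c * t) + c * u x.
have Ay : A y by apply: AD (A_cst _) _; exact: AM (A_cst _) Au.
have y01 x : 0 <= y x <= 1.
  have h1 : `|c * (u x - t)| <= 1 / 2.
    rewrite normrM (gtr0_norm c0) mulrC ler_pdivrMr; last first.
      by rewrite mulr_gt0 // ltr_wpDl // addr_ge0.
    apply: le_trans (ler_normB _ _) _.
    by have := uM x; have := ler_norm M; lra.
  by move: h1; rewrite /y ler_norml; lra.
apply: (@approx_set_cvg (fun n x => (1 - y x ^+ n) ^+ (n * 2 ^ n))) =>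
  [n|n x|x].
- apply/A_approximable/AX.
  have -> : (fun x => 1 - y x ^+ n) = (fun x => 1 + (-1) * y x ^+ n).
    by apply/funext => x; rewrite mulN1r.
  by apply: AD (A_cst _) _; apply: AM (A_cst _) _; exact: AX.
- have /andP[y0 y1] := y01 x.
  by rewrite exprn_ge0 ?exprn_ile1 ?gerBl ?exprn_ge0 // ?subr_ge0 ?exprn_ile1.
- rewrite indicE; have -> : (x \in [set x | u x < t]) = (y x < 1 / 2).
    rewrite /y [RHS](_ : _ = (c * u x < c * t)); last by apply/idP/idP; lra.
    by rewrite ltr_pM2l //; apply/idP/idP => [/set_mem|/mem_set].
  exact: step_approx.
Qed.

Lemma approximable_sum (I : Type) (r : seq I) (g : I -> X -> R) :
  (forall i, approximable (g i)) -> approximable (fun x => \sum_(i <- r) g i x).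
Proof.
move=> gA; elim: r => [|i r IH].
  have -> : (fun x => \sum_(i <- [::]) g i x) = cst 0.
    by apply/funext => x; rewrite big_nil.
  exact: A_approximable.
have -> : (fun x => \sum_(k <- i :: r) g k x) =
          (fun x => g i x + \sum_(k <- r) g k x).
  by apply/funext => x; rewrite big_cons.
exact: approximableD.
Qed.

Hypothesis approx_set_all : forall E, measurable E -> approx_set E.

Import HBNNSimple.

Lemma approximable_nnsfun (h : {nnsfun X >-> R}) : approximable h.
Proof.
have -> : (h : X -> R) = (fun x =>
    \sum_(y <- finmap.enum_fset (fset_set (range h))) y * \1_(h @^-1` [set y])
      x).
  by apply/funext => x; rewrite fimfunE fsbig_finite.
apply: approximable_sum => y; apply: approximableZ.
by have [] := approx_set_all (measurable_sfunP h (measurable_set1 y)).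
Qed.

(** The simple functions below [f] that increase to [f] are within [f] of it. *)
Lemma approximable_ge0 f : measurable_fun setT f -> (forall x, 0 <= f x) ->
  (sq_integral f < +oo)%E -> approximable f.
Proof.
move=> mf f0 sf.
have mEf : measurable_fun setT (EFin \o f) by exact/measurable_EFinP.
pose h := nnsfun_approx measurableT mEf.
have f0' z : setT z -> (0 <= (EFin \o f) z)%E by rewrite lee_fin.
have cv x : h ^~ x @ \oo --> f x.
  have : (h n x)%:E @[n --> \oo] --> (f x)%:E.
    exact: (cvg_nnsfun_approx measurableT mEf f0' I).
  by move/fine_cvgP => [].
apply: (approximable_cvg (f_ := fun n => h n) (G := f)) => //.
  by move=> n; exact: approximable_nnsfun.
move=> n x.
have h0 : 0 <= h n x by [].
have hf : h n x <= f x.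
  rewrite -lee_fin /h nnsfun_approxE.
  by have := le_approx n f0' (I : setT x).
by rewrite ler_sqr ?nnegrE ?subr_ge0 // gerBl.
Qed.

Lemma approximable_all f : measurable_fun setT f ->
  (sq_integral f < +oo)%E -> approximable f.
Proof.
move=> mf sf.
have -> : f = (fun x => f^\+ x + (-1) * f^\- x).
  by rewrite -[LHS]funrposBneg; apply/funext => x /=; rewrite mulN1r.
apply: approximableD; last apply: approximableZ.
- apply: approximable_ge0 => //.
  + exact: measurable_funrpos.
  + apply: le_lt_trans sf; apply: sq_integral_le => //;
    first exact: measurable_funrpos.
    move=> x; rewrite /funrpos; case: (leP (f x) 0) => // _.
    by rewrite expr0n sqr_ge0.
- apply: approximable_ge0 => //.
  + exact: measurable_funrneg.
  + apply: le_lt_trans sf; apply: sq_integral_le => //;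
    first exact: measurable_funrneg.
    move=> x; rewrite /funrneg; case: (leP (- f x) 0) => // _.
      by rewrite expr0n sqr_ge0.
    by rewrite sqrrN.
Qed.

End L2Approximation.

(** * The Borel sets of the tiling space *)

Section Borel.
Context {R : realType} (F : fusion R).
Hypothesis constF : constant_length F.
Variable j0 : forall N, 'I_(ntypes F N).
Local Notation X := (borel_tiling_space F).
Local Notation lvl_len := (lvl_len j0).
Local Notation lvl_size := (lvl_size j0).
Local Notation hull_phase := (hull_phase j0).
Local Notation hull_cell := (hull_cell j0).

Lemma open_measurable_tiling (A : set (hull F 0)) : open A ->
  measurable (A : set X).
Proof. by move=> oA; exact: sub_sigma_algebra. Qed.

Lemma measurable_fun_open_gt (f : X -> R) :
  (forall T, 0 <= f T) ->
  (forall a, 0 <= a -> open ([set T | a < f T] : set (hull F 0))) ->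
  measurable_fun setT f.
Proof.
move=> f0 fo.
apply: (measurability _ (RGenOInfty.measurableE R)) => //.
move=> _ [_ [a ->] <-]; rewrite setTI.
have -> : f @^-1` `]a, +oo[ = [set T | a < f T].
  by apply/seteqP; split => T /=; rewrite in_itv /= andbT.
have [a0|a0] := leP 0 a; first exact: open_measurable_tiling (fo _ a0).
rewrite (_ : [set T | _] = setT) //; apply/seteqP; split => // T _ /=.
exact: lt_le_trans (f0 T).
Qed.

Lemma measurable_hull_phase : measurable_fun setT (@hull_phase 0 : X -> R).
Proof.
apply: measurable_fun_open_gt => [T|a a0].
  by have [/andP[h _] _] := hull_phaseP constF j0 (T : hull F 0); exact: h.
exact: open_hull_phase_gt.
Qed.

(** The left end of cell [d] is [d * l - phase]. If the phase is positive, this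
is the only left end in the open window of length [l] that ends at [d * l]; if
the phase is [0], there is none in that window, and it is the only one within
[l / 2] of [d * l]. *)
Lemma measurable_hull_cell d a : measurable ([set T | hull_cell T d a] : set X).
Proof.
set l := lvl_len 0; have l0 : 0 < l by exact: lvl_len_gt0.
have tint (e : int) : - l < (e - d)%:~R * l < l -> e = d.
  move=> /andP[h1 h2].
  have h3 : (e - d)%:~R < 1%:~R :> R by rewrite -(ltr_pM2r l0) mul1r.
  have h4 : (- 1)%:~R < (e - d)%:~R :> R by rewrite -(ltr_pM2r l0) mulN1r.
  by move: h3 h4; rewrite !ltr_int; lia.
have -> : [set T | hull_cell T d a] =
  [set T | exists2 x, d%:~R * l - l < x < d%:~R * l & hull_tiles T (x, a)] `|`
  (@hull_phase 0 @^-1` [set 0] `&` [set T | exists2 x,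
     d%:~R * l - l / 2 < x < d%:~R * l + l / 2 & hull_tiles T (x, a)]).
  apply/seteqP; split => T /=.
    have [/andP[p0 pl] _] := hull_phaseP constF j0 T; rewrite -/l in pl.
    move=> Ta; move: p0; rewrite le_eqVlt => /orP[/eqP p0|p0].
      right; split => //; exists (- hull_phase T + d%:~R * l) => //.
      by rewrite -p0; apply/andP; split; lra.
    by left; exists (- hull_phase T + d%:~R * l) => //; apply/andP; split; lra.
  have [/andP[p0 pl] _] := hull_phaseP constF j0 T; rewrite -/l in pl.
  case=> [[x xd Tx]|[pz [x xd Tx]]];
    have [e xe] := hull_phase_tile constF j0 Tx.
    suff <- : e = d by rewrite /hull_cell /cell -/(hull_phase T) -xe.
    by apply: tint; rewrite intrB; move: xd; rewrite xe -/l; lra.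
  suff <- : e = d by rewrite /hull_cell /cell -/(hull_phase T) -xe.
  by apply: tint; rewrite intrB; move: xd; rewrite xe -/l pz; lra.
apply: measurableU; first by apply: open_measurable_tiling;
  exact: open_tile_window.
apply: measurableI; last by apply: open_measurable_tiling;
  exact: open_tile_window.
rewrite -[X in measurable X]setTI.
exact: measurable_hull_phase measurableT _ (measurable_set1 0).
Qed.

Definition matches (T : hull F 0) (c : seq (int * 'I_(ntypes F 0))) : Prop :=
  forall u, u \in c -> hull_cell T u.1 u.2.

(** The sets [phase < x] and the prescriptions of finitely many cells form
together a system stable under intersection, on which measures are compared. *)
Definition cylinder c (x : R) : set X :=
  [set T | matches T c /\ hull_phase (T : hull F 0) < x].

Definition cylinders : set (set X) :=
  [set E | exists c x, E = cylinder c x].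

Lemma matches_cat T c c' : matches T (c ++ c') <-> matches T c /\ matches T c'.
Proof.
split=> [h|[h h'] u]; last by rewrite mem_cat => /orP[/h|/h'].
by split => u uc; apply: h; rewrite mem_cat uc ?orbT.
Qed.

Lemma cylindersI : setI_closed cylinders.
Proof.
move=> _ _ [c [x ->]] [c' [x' ->]]; exists (c ++ c'), (Num.min x x').
apply/seteqP; split => T; rewrite /cylinder /= lt_min.
  by move=> [[h1 ->] [h2 ->]]; split => //; apply/matches_cat.
by move=> [/matches_cat[h1 h2] /andP[-> ->]].
Qed.

Lemma measurable_matches c : measurable ([set T | matches T c] : set X).
Proof.
elim: c => [|[d a] c IH].
  by rewrite (_ : [set T | _] = setT) //; apply/seteqP; split.
rewrite (_ : [set T | _] = [set T | hull_cell T d a] `&` [set T | matches T c]).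
  by apply: measurableI => //; exact: measurable_hull_cell.
apply/seteqP; split => T /=.
  move=> h; split; first by apply: (h (d, a)); rewrite mem_head.
  by move=> u uc; apply: h; rewrite inE uc orbT.
by move=> [h h'] u; rewrite inE => /orP[/eqP ->|/h'].
Qed.

Lemma cylinderE c x : cylinder c x =
  [set T | matches T c] `&` @hull_phase 0 @^-1` `]-oo, x[%classic.
Proof. by apply/seteqP; split => T /=; rewrite in_itv. Qed.

Lemma measurable_cylinder c x : measurable (cylinder c x).
Proof.
rewrite cylinderE; apply: measurableI; first exact: measurable_matches.
rewrite -[X in measurable X]setTI.
exact: measurable_hull_phase.
Qed.

(** Translating by the small difference of the phases makes the two tilings
agree on all the cells that meet the ball of radius [1 / e]. *)
Lemma close_of_matches (T : hull F 0) e : 0 < e -> exists2 c, matches T c &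
  forall S : hull F 0, matches S c -> `|hull_phase S - hull_phase T| < e ->
    tilings_close (@st_len R F 0) e T S.
Proof.
move=> e0; set l := lvl_len 0; have l0 : 0 < l by exact: lvl_len_gt0.
have /choice[t tP] : forall d, exists a, hull_cell T d a :=
  hull_cell_ex constF j0 T.
(* The offset 3 makes room for the two cells that meet the ends of the ball. *)
pose M : nat := (Num.trunc (e^-1 / l)).+3.
exists [seq (i%:Z - M%:Z, t (i%:Z - M%:Z)) | i <- iota 0 (M + M)].
  by move=> u /mapP[i _ ->].
move=> S mS pST.
have inM (d : int) : `|d%:~R * l| <= e^-1 + l + l -> exists2 i : nat,
  (i < M + M)%N & d = i%:Z - M%:Z.
  move=> dl.
  have dM : `|d| < M%:Z.
    rewrite -(ltr_int R) -(ltr_pM2r l0) intr_norm.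
    rewrite -[X in _ * X](gtr0_norm l0) -normrM; apply: le_lt_trans dl _.
    have ie0 : 0 <= e^-1 by rewrite invr_ge0 ltW.
    have /andP[_] := truncn_itv (divr_ge0 ie0 (ltW l0)).
    rewrite ltr_pdivrMr // /M => h.
    have -> : (Num.trunc (e^-1 / l)).+3%:~R * l =
              (Num.trunc (e^-1 / l)).+1%:R * l + l + l :> R.
      by rewrite -[_%:~R]/(_.+3%:R) -natr1 -[in LHS]natr1; ring.
    by rewrite !ltrD2r.
  exists `|(d + M%:Z)%R|%N; lia.
exists 0, (hull_phase S - hull_phase T); split;
  [by rewrite normr0 ltW|exact: ltW|].
move=> [y i] [z [yz zr]].
have bound (d : int) : y = - hull_phase T + d%:~R * l -> `|d%:~R * l| <= e^-1 +
  l + l.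
  have [/andP[p0 pl] _] := hull_phaseP constF j0 T.
  have {}yz : y <= z <= y + l by rewrite -[l](st_lenE constF j0 i); exact: yz.
  move=> ye.
  move: zr; rewrite /= !ler_norml => zr; move: pl; rewrite -/l; lra.
rewrite translate0 /translate /=.
have cellS d : `|d%:~R * l| <= e^-1 + l + l -> hull_cell S d (t d).
  move=> /inM[k kM ->]; apply: (mS (_, _)); apply/mapP; exists k => //.
  by rewrite mem_iota.
split => Ty.
  have [d yd] := hull_phase_tile constF j0 Ty.
  have dl := bound _ yd.
  have ti : t d = i.
    by apply: (hull_cell_uniq constF (tP d));
      rewrite /hull_cell /cell -/(hull_phase T) -yd.
  have := cellS d dl; rewrite ti /hull_cell /cell -/(hull_phase S).
  by rewrite yd; congr (hull_tiles S (_, i)); rewrite -/l; ring.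
have [d yd] := hull_phase_tile constF j0 Ty.
have yd' : y = - hull_phase T + d%:~R * l by move: yd; rewrite -/l; lra.
have ti : t d = i.
  apply: (hull_cell_uniq constF (cellS d (bound _ yd'))).
  by rewrite /hull_cell /cell -/(hull_phase S) -yd.
by have := tP d; rewrite ti yd'.
Qed.

(** An open set is the union, over the countably many finite lists [c] of
prescribed cells, of the tilings that match [c] and have their phase in an open
set [U c] of the line. *)
Lemma cylinders_generate : @measurable _ X = <<s cylinders >>.
Proof.
apply/seteqP; split; last first.
  apply: smallest_sub; first exact: sigma_algebra_measurable.
  by move=> _ [c [x ->]]; exact: measurable_cylinder.
apply: smallest_sub; first exact: smallest_sigma_algebra.
move=> A; rewrite /= hull_openE => oA.
pose U c := [set x : R | exists2 e, 0 < e & forall S : hull F 0,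
  matches S c -> `|hull_phase S - x| < e -> A S].
have oU c : open (U c).
  rewrite openE => x [e e0 eA]; apply/nbhs_ballP.
  exists (e / 2) => /=; first by rewrite divr_gt0.
  move=> y xy; exists (e / 2); first by rewrite divr_gt0.
  move=> S mS Sy; apply: eA => //; rewrite [e]splitr.
  apply: le_lt_trans (ler_distD y _ _) _; apply: ltrD => //.
  by rewrite distrC.
pose Y := g_sigma_algebraType cylinders.
have mphase : measurable_fun setT (@hull_phase 0 : Y -> R).
  apply: (measurability _ (RGenInftyO.measurableE R)) => //.
  move=> _ [_ [a ->] <-]; rewrite setTI.
  apply: sub_sigma_algebra; exists [::], a.
  by rewrite cylinderE; apply/seteqP; split => T //= [].
have mU c : measurable ([set T | matches T c] `&` @hull_phase 0 @^-1` (U c) :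
  set Y).
  apply: measurableI.
    have -> : [set T | matches T c] =
        \bigcup_n cylinder c n%:R.
      apply/seteqP; split => T /= => [h|[n _ []] //].
      exists (Num.trunc (hull_phase T)).+1 => //; split => //.
      have [/andP[p0 pl] _] := hull_phaseP constF j0 T.
      by have /andP[] := truncn_itv p0.
    by apply: bigcup_measurable => n _; apply: sub_sigma_algebra;
      exists c, n%:R.
  rewrite -[X in measurable X]setTI; apply: mphase => //.
  exact: open_measurable.
have -> : A = \bigcup_(c in [set: seq (int * 'I_(ntypes F 0))])
    ([set T | matches T c] `&` @hull_phase 0 @^-1` (U c)).
  apply/seteqP; split => T; last first.
    by move=> [c _ [mT [e e0]]]; apply => //; rewrite subrr normr0.
  move=> AT; have [e e0 eA] := oA T AT.
  have [c mT cP] := close_of_matches T e0; exists c => //; split => //.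
  by exists e => // S mS ST; apply: eA; exact: cP.
apply: (@countable_bigcupT_measurable _ Y) => //; exact: countableP.
Qed.

End Borel.

(** * Trigonometric polynomials in the phases *)

Section UniformIndex.
Context d (T : measurableType d) (R : realType) (mu : {measure set T -> \bar
  R}).
Variables (f : T -> nat) (Q : nat) (m : \bar R).
Hypothesis mf : forall s, measurable [set x | f x = s].
Hypothesis fm : forall s, (s < Q)%N -> mu [set x | f x = s] = m.

Let split_last (P : pred nat) k :
  [set x | (f x < k.+1)%N && P (f x)] = [set x | (f x < k)%N && P (f x)] `|`
    (if P k then [set x | f x = k] else set0).
Proof.
apply/seteqP; split => x /=.
  rewrite ltnS leq_eqVlt => /andP[/orP[/eqP e|->] Pk]; last by left.
  by right; rewrite -e Pk.
case=> [/andP[h ->]|]; first by rewrite (ltn_trans h).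
by case: ifP => // Pk /= ->; rewrite ltnSn Pk.
Qed.

Lemma measurable_index_lt (P : pred nat) k :
  measurable [set x | (f x < k)%N && P (f x)].
Proof.
elim: k => [|k IH].
  by rewrite (_ : [set x | _] = set0) //; apply/seteqP; split.
by rewrite split_last; apply: measurableU => //; case: ifP.
Qed.

Lemma measurable_index (P : pred nat) : measurable [set x | P (f x)].
Proof.
have -> : [set x | P (f x)] = \bigcup_k [set x | (f x < k)%N && P (f x)].
  apply/seteqP; split => x /= => [Px|[k _ /andP[]] //].
  by exists (f x).+1; rewrite //= ltnSn.
by apply: bigcup_measurable => k _; exact: measurable_index_lt.
Qed.

Lemma measure_index_lt (P : pred nat) k : (k <= Q)%N ->
  mu [set x | (f x < k)%N && P (f x)] = ((\sum_(s < k) P s)%N%:R%:E * m)%E.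
Proof.
elim: k => [|k IH] kQ.
  rewrite big_ord0 mul0e (_ : [set x | _] = set0) ?measure0 //.
  by apply/seteqP; split.
rewrite split_last measureU //; last 3 first.
- exact: measurable_index_lt.
- by case: ifP.
- apply/seteqP; split => x //= [/andP[h _]]; case: ifP => // _ /= e.
  by move: h; rewrite e ltnn.
rewrite big_ord_recr /= IH; last exact: ltnW.
case: (P k); last by rewrite measure0 adde0 addn0.
by rewrite fm // natrD EFinD ge0_muleDl ?lee_fin // mul1e.
Qed.

End UniformIndex.

Section CosInt.
Context {R : realType}.

Lemma cos_2pi_int (x : R) (z : int) : cos (x + 2 * pi * z%:~R) = cos x.
Proof.
have per (y : R) n : cos (y + 2 * pi * n%:R) = cos y.
  have -> : 2 * pi * n%:R = (pi *+ 2) *+ n :> R.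
    by rewrite -[RHS]mulr_natr -[pi *+ 2]mulr_natl.
  exact: (periodicn (@cosD2pi R)).
case: z => n; first exact: per.
by rewrite NegzE intrN mulrN -[LHS](per _ n.+1) subrK.
Qed.

End CosInt.

Section Trig.
Context {R : realType} (F : fusion R).
Hypothesis constF : constant_length F.
Variable j0 : forall N, 'I_(ntypes F N).
Local Notation X := (borel_tiling_space F).
Local Notation lvl_len := (lvl_len j0).
Local Notation lvl_size := (lvl_size j0).
Variable G : forall n, hull F 0 -> hull F n.
Hypothesis liftG : is_lift G.
Local Notation level_phase := (level_phase j0 G).
Local Notation slot := (slot j0 G).

Definition angle n (T : X) : R := 2 * pi * (level_phase n T / lvl_len n).

(** The components of [t] are an amplitude, a phase, a level and a frequency. *)
Definition harmonic_term (t : R * R * nat * int) (T : X) : R :=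
  let: (a, phi, n, q) := t in a * cos (q%:~R * angle n T + phi).

Definition trigpoly (s : seq (R * R * nat * int)) (T : X) : R :=
  \sum_(t <- s) harmonic_term t T.

Definition trigpolys : set (X -> R) := [set u | exists s, u = trigpoly s].

Lemma lvl_len_refine n N : (n <= N)%N ->
  exists r : nat, lvl_len N = r%:R * lvl_len n.
Proof.
move=> nN; rewrite -(subnK nN); elim: (N - n)%N => [|m [r IH]].
  by exists 1%N; rewrite mul1r.
exists (arity j0 (m + n) * r)%N.
by rewrite addSn (lvl_lenS constF) IH natrM mulrA.
Qed.

(** The phases of levels [n] and [N] differ by a multiple of [lvl_len n], and
[lvl_len N] is a multiple of [lvl_len n]: a harmonic of level [n] is a harmonic
of level [N], with its frequency multiplied by [r]. *)
Lemma angle_refine n N : (n <= N)%N -> exists r : int, forall (q : int) phi T,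
  cos (q%:~R * angle n T + phi) = cos ((q * r)%:~R * angle N T + phi).
Proof.
move=> nN; have [r rE] := lvl_len_refine nN; exists r => q phi T.
have [d dE] := level_phase_refine constF j0 liftG T nN.
rewrite -[RHS](cos_2pi_int _ (- (q * d))); congr cos.
have l0 : lvl_len n != 0 by rewrite gt_eqF // lvl_len_gt0.
have r0 : (r%:R : R) != 0.
  apply/eqP => r0; have := lvl_len_gt0 j0 N.
  by rewrite rE r0 mul0r ltxx.
rewrite /angle dE rE intrN !intrM -pmulrn; field.
by rewrite l0 r0.
Qed.

(** After both factors are moved to a common level, the product of two cosines
is a sum of two cosines. *)
Lemma harmonic_termM t t' : exists s, forall T,
  harmonic_term t T * harmonic_term t' T = trigpoly s T.
Proof.
case: t t' => [[[a phi] n] q] [[[a' phi'] n'] q'].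
have [r rE] := angle_refine (leq_maxl n n').
have [r' rE'] := angle_refine (leq_maxr n n').
exists [:: (a * a' / 2, phi + phi', maxn n n', q * r + q' * r');
           (a * a' / 2, phi - phi', maxn n n', q * r - q' * r')] => T.
rewrite /trigpoly !big_cons big_nil addr0 /harmonic_term rE rE'.
set B := angle _ _; set x := (q * r)%:~R * B + phi.
set y := (q' * r')%:~R * B + phi'.
have -> : (q * r + q' * r')%:~R * B + (phi + phi') = x + y.
  by rewrite /x /y intrD; ring.
have -> : (q * r - q' * r')%:~R * B + (phi - phi') = x - y.
  by rewrite /x /y intrB; ring.
by clearbody x y; rewrite cosD cosB; field.
Qed.

Lemma trigpolyD s s' T : trigpoly (s ++ s') T = trigpoly s T + trigpoly s' T.
Proof. by rewrite /trigpoly big_cat. Qed.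

Lemma measurable_level_phase n : measurable_fun setT (level_phase n : X -> R).
Proof.
apply: measurable_fun_open_gt => [T|a a0].
  by have /andP[] := level_phase_itv constF j0 G n (T : hull F 0).
exact: open_level_phase_gt.
Qed.

Lemma measurable_angle n : measurable_fun setT (angle n).
Proof.
apply: measurable_funM; first exact: measurable_cst.
apply: measurable_funM; last exact: measurable_cst.
exact: measurable_level_phase.
Qed.

Lemma measurable_harmonic t : measurable_fun setT (harmonic_term t).
Proof.
case: t => [[[a phi] n] q]; apply: measurable_funM; first exact: measurable_cst.
apply: measurableT_comp.
  by apply: continuous_measurable_fun; exact: continuous_cos.
apply: measurable_funD; last exact: measurable_cst.
by apply: measurable_funM; [exact: measurable_cst|exact: measurable_angle].
Qed.

Lemma trigpoly_cons t s :
  trigpoly (t :: s) = (fun T => harmonic_term t T + trigpoly s T).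
Proof. by apply/funext => T; rewrite /trigpoly big_cons. Qed.

Lemma trigpolys_algebra : bounded_algebra trigpolys.
Proof.
split.
- move=> c; exists [:: (c, 0, 0%N, 0)]; apply/funext => T.
  by rewrite trigpoly_cons /trigpoly big_nil /= mul0r add0r cos0 mulr1 addr0.
- move=> _ _ [s ->] [s' ->]; exists (s ++ s'); apply/funext => T.
  by rewrite trigpolyD.
- move=> _ _ [s ->] [s' ->].
  suff [s'' E] : exists s'', forall T,
    trigpoly s T * trigpoly s' T = trigpoly s'' T.
    by exists s''; apply/funext.
  elim: s => [|t s [s1 IH]].
    by exists [::] => T; rewrite {1 3}/trigpoly !big_nil mul0r.
  have [s2 E2] : exists s2, forall T,
      harmonic_term t T * trigpoly s' T = trigpoly s2 T.
    elim: s' {IH} => [|t' s' [s3 IH]].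
      by exists [::] => T; rewrite /trigpoly !big_nil mulr0.
    have [s4 E4] := harmonic_termM t t'; exists (s4 ++ s3) => T.
    by rewrite trigpoly_cons trigpolyD mulrDr IH E4.
  by exists (s2 ++ s1) => T; rewrite trigpoly_cons trigpolyD mulrDl IH E2.
- move=> _ [s ->]; elim: s => [|t s IH].
    have -> : trigpoly [::] = cst 0 by apply/funext => T;
      rewrite /trigpoly big_nil.
    exact: measurable_cst.
  by rewrite trigpoly_cons; apply: measurable_funD => //;
    exact: measurable_harmonic.
- move=> _ [s ->]; elim: s => [|t s [M IH]].
    by exists 0 => T; rewrite /trigpoly big_nil normr0.
  exists (`|t.1.1.1| + M) => T; rewrite trigpoly_cons.
  apply: le_trans (ler_normD _ _) (lerD _ (IH T)).
  case: t => [[[a phi] n] q] /=; rewrite normrM ler_piMr //.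
  exact: cos_max.
Qed.

Lemma trigpolys_cos n : trigpolys (fun T => cos (angle n T)).
Proof.
exists [:: (1, 0, n, 1)]; apply/funext => T.
by rewrite trigpoly_cons /trigpoly big_nil /= !mul1r !addr0.
Qed.

Lemma trigpolys_sin n : trigpolys (fun T => sin (angle n T)).
Proof.
exists [:: (1, - (pi / 2), n, 1)]; apply/funext => T.
by rewrite trigpoly_cons /trigpoly big_nil /= !mul1r !addr0 cosBpihalf.
Qed.

Section InvariantMeasure.
Variable mu : {measure set X -> \bar R}.
Hypothesis mu_fin : (mu [set: X] < +oo)%E.
Local Notation H := (approx_set mu trigpolys).

Let algT := trigpolys_algebra.
Let HC := approx_setC (mu := mu) algT.
Let HI := approx_setI (mu := mu) algT.
Let HU := approx_setU (mu := mu) algT.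
Let H0 := approx_set0 mu algT.
Let Hcup := approx_set_bigcup mu_fin algT.
Let Hlt := approx_set_lt mu_fin algT.

Lemma approx_set_ext (E E' : set X) : (forall T, E T <-> E' T) -> H E -> H E'.
Proof.
by move=> EE'; suff -> : E = E' by []; apply/seteqP; split => T /EE'.
Qed.

Lemma approx_set_gt u t : trigpolys u -> H [set T | t < u T].
Proof.
move=> Au; rewrite (_ : [set T | t < u T] = [set T | -1 * u T < - t]).
  by apply: Hlt; case: algT => h _ h' _ _; apply: h' => //; exact: h.
by apply/seteqP; split => T /=; lra.
Qed.

Lemma approx_set_ge u t : trigpolys u -> H [set T | t <= u T].
Proof.
move=> Au; rewrite (_ : [set T | t <= u T] = ~` [set T | u T < t]).
  by apply: HC; exact: Hlt.
by apply/seteqP; split => T /=; rewrite leNgt; [move/negP|move=> h; apply/negP].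
Qed.

Lemma angle_itv n T : 0 <= angle n T < 2 * pi.
Proof.
have /andP[p0 pl] := level_phase_itv constF j0 G n (T : hull F 0).
have l0 := lvl_len_gt0 j0 n; have pp := @pi_gt0 R.
rewrite /angle mulr_ge0 ?divr_ge0 ?(ltW l0) ?mulr_ge0 ?(ltW pp) //=.
rewrite -[ltRHS]mulr1 ltr_pM2l ?mulr_gt0 //.
by rewrite ltr_pdivrMr // mul1r.
Qed.

Lemma sin_ge0_angle n T : (0 <= sin (angle n T)) = (angle n T <= pi).
Proof.
have /andP[a0 a2] := angle_itv n T; apply/idP/idP => [|api]; last first.
  by rewrite sin_ge0_pi // a0.
move=> s0; rewrite leNgt; apply/negP => pa; move: s0; apply/negP;
  rewrite -ltNge.
have -> : angle n T = (angle n T - pi) + pi by rewrite subrK.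
by rewrite sinDpi oppr_lt0 sin_gt0_pi //; lra.
Qed.

Lemma cos_flip (x : R) : cos x = cos (2 * pi - x).
Proof.
rewrite -[LHS]cosN -(cos_2pi_int (- x) 1) mulr1 addrC //.
Qed.

(** The sign of the sine tells in which half of the circle the angle is, and on
each half the cosine is monotone. *)
Lemma approx_set_angle_lt n t : H [set T | angle n T < t].
Proof.
have [t0|t0] := leP t 0.
  apply: approx_set_ext H0 => T /=; have /andP[a0 a2] := angle_itv n T.
  by split => //; lra.
have [t2|t2] := leP (2 * pi) t.
  apply: approx_set_ext (HC H0) => T /=; have /andP[a0 a2] := angle_itv n T.
  by split => // _; lra.
have inpi (x : R) : 0 <= x <= pi -> x \in `[0, pi] by rewrite in_itv.
have [tp|tp] := leP t pi.
  apply: approx_set_ext (HI (approx_set_ge 0 (trigpolys_sin n))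
    (approx_set_gt (cos t) (trigpolys_cos n))) => T /=.
  have /andP[a0 a2] := angle_itv n T; rewrite sin_ge0_angle; split.
    by move=> [ap]; rewrite ltr_cos //; apply: inpi; lra.
  by move=> at_; split; [|rewrite ltr_cos //; apply: inpi]; lra.
apply: approx_set_ext (HU (approx_set_ge 0 (trigpolys_sin n))
  (Hlt (cos t) (trigpolys_cos n))) => T /=.
have /andP[a0 a2] := angle_itv n T; rewrite sin_ge0_angle.
have [ap|ap] := leP (angle n T) pi; first by split => [_|_]; [lra|left].
rewrite cos_flip (cos_flip t) ltr_cos; try by apply: inpi; lra.
by split => [[]|at_]; [lra|lra|right; lra].
Qed.

Lemma approx_set_level_phase_lt n x : H [set T | level_phase n T < x].
Proof.
have l0 := lvl_len_gt0 j0 n; have pp := @pi_gt0 R.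
apply: approx_set_ext (approx_set_angle_lt n (2 * pi * (x / lvl_len n))) =>
  T /=.
by rewrite /angle ltr_pM2l ?mulr_gt0 // ltr_pM2r ?invr_gt0.
Qed.

(** The slot is the integer part of the phase, measured in prototiles. *)
Lemma approx_set_slot n s : H [set T | slot n T = s].
Proof.
have l0 := lvl_len_gt0 j0 0.
apply: approx_set_ext (HI (approx_set_level_phase_lt n (s.+1%:R * lvl_len 0))
  (HC (approx_set_level_phase_lt n (s%:R * lvl_len 0)))) => T /=; split.
  have /andP[p0 _] := level_phase_itv constF j0 G n (T : hull F 0).
  move=> [h1 /negP]; rewrite -leNgt => h2.
  rewrite /slot; apply/truncn_def.
  by rewrite ler_pdivlMr // ltr_pdivrMr // h2.
have [_ -> _] := slotP constF j0 liftG n T.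
have [/andP[p0 pl] _] := hull_phaseP constF j0 (T : hull F 0).
by move=> ->; rewrite -natr1; split; [lra|apply/negP; rewrite -leNgt; lra].
Qed.

Hypothesis mu_inv : forall (v : R) (E : set X), measurable E ->
  mu (hull_shift v @^-1` E) = mu E.

(** Translation by one prototile advances the slot by one, except at the last
slot. *)
Lemma slot_shift n s T : (s.+1 < lvl_size n)%N ->
  slot n (hull_shift (- lvl_len 0) T) = s.+1 <-> slot n T = s.
Proof.
move=> sw; have l0 := lvl_len_gt0 j0 0.
have [w1 e1 _] := slotP constF j0 liftG n T.
have [w2 e2 _] := slotP constF j0 liftG n (hull_shift (- lvl_len 0) T).
have [/andP[p0 pl] _] := hull_phaseP constF j0 (T : hull F 0).
have [/andP[p0' pl'] _] := hull_phaseP constF j0 (hull_shift (- lvl_len 0) T).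
have [z ze] := level_phase_shift constF j0 liftG n T (lvl_len 0).
have lN : lvl_len n = (lvl_size n)%:R * lvl_len 0 by exact: lvl_lenE.
move: ze; rewrite e1 e2 lN.
have : exists k : int, hull_phase j0 (hull_shift (- lvl_len 0) T) =
    hull_phase j0 (T : hull F 0) + k%:~R * lvl_len 0.
  have [k ke] := hull_phase_shift constF j0 (T : hull F 0) (lvl_len 0).
  by exists (1 + k); rewrite ke intrD mulrDl mul1r addrA.
move=> [k ke].
have k0 : k = 0.
  have h3 : k%:~R < 1%:~R :> R by rewrite -(ltr_pM2r l0) mul1r; lra.
  have h4 : (- 1)%:~R < k%:~R :> R by rewrite -(ltr_pM2r l0) mulN1r; lra.
  by move: h3 h4; rewrite !ltr_int; lia.
rewrite ke k0 mul0r addr0 => ze.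
have : (slot n (hull_shift (- lvl_len 0) T))%:Z =
       (slot n T)%:Z + 1 + z * (lvl_size n)%:Z.
  apply/eqP; rewrite -(eqr_int R); apply/eqP/(mulIf (lt0r_neq0 l0)).
  by rewrite !intrD intrM; move: ze; rewrite -!pmulrn; lra.
have zc : z <= -1 \/ z = 0 \/ 1 <= z by lia.
move: w1 w2 sw; case: zc => [z1|[->|z1]]; last 2 first.
- by lia.
- by nia.
- by nia.
Qed.

Lemma measurable_slot n s : measurable ([set T | slot n T = s] : set X).
Proof. exact: (approx_set_slot n s).1. Qed.

(** Consecutive slots are exchanged by the translation by one prototile, which
preserves the measure. *)
Lemma measure_slot n s : (s < lvl_size n)%N ->
  mu [set T | slot n T = s] = mu [set T | slot n T = 0%N].
Proof.
elim: s => // s IH sw; rewrite -IH; last exact: ltnW.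
rewrite -(mu_inv (- lvl_len 0) (measurable_slot n s.+1)); congr (mu _).
by apply/seteqP; split => T /= h; apply/(slot_shift _ sw).
Qed.

Lemma measure_slots n (P : pred nat) :
  mu [set T | P (slot n T)] =
  ((\sum_(s < lvl_size n) P s)%N%:R%:E * mu [set T | slot n T = 0%N])%E.
Proof.
rewrite -(measure_index_lt (measurable_slot n) (@measure_slot n)) //.
congr (mu _); apply/seteqP; split => T /=.
  by have [-> _ _] := slotP constF j0 liftG n T.
by case/andP.
Qed.

Hypothesis coincF : mostly_coincident j0.

(** All slots having the same measure, the measure of this event is proportional
to the number of its slots, which [mostly_coincident] bounds. *)
Lemma measure_bad_small d e : 0 < e -> exists N,
  (mu [set T | ~~ coincident j0 N ((slot N T)%:Z + d)] <= e%:E)%E.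
Proof.
move=> e0; have e1 : 0 < e / (fine (mu setT) + 1).
  by rewrite divr_gt0 // ltr_wpDl // fine_ge0.
have [N NP] := coincF d e1; exists N.
rewrite (measure_slots N (fun s => ~~ coincident j0 N (s%:Z + d))).
set m := mu [set T | slot N T = 0%N].
have muT : (mu setT = (lvl_size N)%:R%:E * m)%E.
  have := measure_slots N predT; rewrite -/m.
  rewrite (eq_bigr (fun=> 1%N)) ?sum1_card ?card_ord // => <-.
  by congr (mu _); apply/seteqP; split.
have finT : mu setT \is a fin_num by rewrite ge0_fin_numE.
have m0 : (0 <= m)%E by exact: measure_ge0.
have finm : m \is a fin_num.
  rewrite ge0_fin_numE //; apply: le_lt_trans mu_fin.
  exact: (le_measure mu (mem_set (measurable_slot N 0%N)) (mem_set measurableT)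
    (@subsetT _ _)).
have Tm : fine (mu setT) = (lvl_size N)%:R * fine m.
  by rewrite muT fineM.
rewrite -(fineK finm) -EFinM lee_fin.
have fm0 : 0 <= fine m by rewrite fine_ge0.
apply: le_trans (ler_wpM2r fm0 NP) _.
rewrite -mulrA -Tm -mulrA ler_piMr ?(ltW e0) // mulrC ler_pdivrMr ?mul1r ?lerDl
  //.
Qed.

(** On the tilings for which position [slot N T + d] is coincident, cell [d] has
type [a] if and only if the common prototile is [a], which is a condition on the
slot alone; the other tilings form a set of small measure. *)
Lemma approx_set_hull_cell d a : H [set T | hull_cell j0 T d a].
Proof.
have mE := measurable_hull_cell constF j0 d a.
have mI (E : set X) : measurable E -> measurable_fun setT (\1_E : X -> R).
  by move=> mE'; exact: measurable_indic.
split => //; apply: (approximable_lim algT) => [|e e0]; first exact: mI.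
have [|N NP] := measure_bad_small d (e := e / 2); first by rewrite divr_gt0.
pose E_ := [set T : X | coincides j0 N ((slot N T)%:Z + d) a].
pose D := [set T : X | ~~ coincident j0 N ((slot N T)%:Z + d)].
have HE : H E_.
  apply: approx_set_ext (Hcup (E := fun s => if coincides j0 N (s%:Z + d) a
     then [set T | slot N T = s] else set0) _) => [T|s]; last first.
    by case: ifP => // _; exact: approx_set_slot.
  split=> [[s _]|ET]; first by case: ifP => // h /= e'; rewrite /E_ /= e'.
  by exists (slot N T) => //; rewrite ifT.
have mD : measurable D.
  have := measurable_slot N; move=> ms.
  have -> : D = \bigcup_s (if ~~ coincident j0 N (s%:Z + d)
     then [set T | slot N T = s] else set0).
    apply/seteqP; split => T /=.
      by move=> DT; exists (slot N T) => //; rewrite ifT.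
    by move=> [s _]; case: ifP => // h /= e'; rewrite /D /= e'.
  by apply: bigcup_measurable => s _; case: ifP.
exists (\1_E_); first exact: HE.2.
apply: (@le_lt_trans _ _ (e / 2)%:E); last by rewrite lte_fin; lra.
have muD : mu D = (\int[mu]_x (\1_D x)%:E)%E by rewrite integral_indic // setIT.
apply: le_trans NP; rewrite -/D muD.
apply: ge0_le_integral => //.
- by move=> x _; rewrite lee_fin sqr_ge0.
- apply: measurable_sq; apply: measurable_funB; apply: mI => //.
  exact: HE.1.
- by apply/measurable_EFinP; exact: mI.
move=> T _; rewrite lee_fin !indicE.
have [|nD] := boolP (T \in D).
  by move=> _; do 2 case: (_ \in _);
    rewrite /= ?subrr ?expr0n ?subr0 ?sub0r ?sqrrN ?expr1n.
have [b hb] : exists b, coincides j0 N ((slot N T)%:Z + d) b.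
  by apply/existsP; apply: contraR nD => h; apply/mem_set.
have hbT := coincides_hull_cell constF liftG hb.
suff -> : (T \in [set T | hull_cell j0 T d a]) = (T \in E_) by rewrite subrr
  expr0n.
apply/idP/idP => /set_mem /= h; apply/mem_set => /=.
  by rewrite /E_ /= -(hull_cell_uniq constF hbT h).
exact: (coincides_hull_cell constF liftG h).
Qed.

(** The approximable sets form a sigma-algebra that contains the generating
cylinders. *)
Lemma approx_set_all E : measurable E -> H E.
Proof.
rewrite (cylinders_generate constF j0); apply: smallest_sub.
  exact: approx_set_sigma_algebra.
move=> _ [c [x ->]]; rewrite cylinderE.
apply: HI; last first.
  apply: approx_set_ext (approx_set_level_phase_lt 0 x) => T;
    rewrite /= /level_phase in_itv /=.
  by have [-> _ _ _] := liftG.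
elim: c => [|[d a] c IH].
  by apply: approx_set_ext (HC H0) => T; split=> [_ u|_ []].
apply: approx_set_ext (HI (approx_set_hull_cell d a) IH) => T /=; split.
  by move=> [h h'] u; rewrite inE => /orP[/eqP ->|/h'].
move=> h; split; first by apply: (h (d, a)); rewrite mem_head.
by move=> u uc; apply: h; rewrite inE uc orbT.
Qed.

End InvariantMeasure.
End Trig.

(** * Pure point spectrum and uniqueness of the invariant measure *)

Section SpectrumTheorems.
Context {R : realType} (F : fusion R).
Hypothesis constF : constant_length F.
Variable j0 : forall N, 'I_(ntypes F N).
Local Notation X := (borel_tiling_space F).
Local Notation C := (R[i]).
Local Notation lvl_len := (lvl_len j0).
Local Notation lvl_size := (lvl_size j0).
Variable G : forall n, hull F 0 -> hull F n.
Hypothesis liftG : is_lift G.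
Local Notation angle := (angle j0 G).
Local Notation trigpoly := (trigpoly j0 G).
Hypothesis coincF : mostly_coincident j0.

Lemma sin_2pi_int (x : R) (z : int) : sin (x + 2 * pi * z%:~R) = sin x.
Proof. by rewrite -!cosBpihalf addrAC cos_2pi_int. Qed.

Lemma angle_shift n T v : exists z : int,
  angle n (hull_shift (- v) T) = angle n T + 2 * pi * (v / lvl_len n) + 2 * pi *
    z%:~R.
Proof.
have l0 : lvl_len n != 0 by rewrite gt_eqF // lvl_len_gt0.
have [z ze] := level_phase_shift constF j0 liftG n T v; exists z.
by rewrite /angle ze; field.
Qed.

(** A phase of level [n] is only defined modulo [lvl_len n], and this is a well
defined function of its class. *)
Definition character n (q : int) (T : X) : C :=
  Complex (cos (q%:~R * angle n T)) (sin (q%:~R * angle n T)).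

Lemma character_eigen n q : eigenfunction (character n q).
Proof.
have mA : measurable_fun setT (fun T : X => q%:~R * angle n T).
  apply: measurable_funM; first exact: measurable_cst.
  exact: measurable_angle.
split.
- split.
    apply: (@measurableT_comp _ _ _ _ _ _ (@cos R)) mA.
    by apply: continuous_measurable_fun; exact: continuous_cos.
  apply: (@measurableT_comp _ _ _ _ _ _ (@sin R)) mA.
  by apply: continuous_measurable_fun; exact: continuous_sin.
- by move=> T; rewrite /character /Normc.normc cos2Dsin2 sqrtr1.
- exists (q%:~R / lvl_len n) => T v.
  have [z ze] := angle_shift n T v.
  have E : q%:~R * angle n (hull_shift (- v) T) =
     (2 * pi * (q%:~R / lvl_len n) * v + q%:~R * angle n T) + 2 * pi * (q *
       z)%:~R.
    by rewrite ze intrM; ring.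
  rewrite /character E cos_2pi_int sin_2pi_int cosD sinD.
  by congr Complex; ring.
Qed.

Definition character_sum (s : seq (C * (nat * int))) (T : X) : C :=
  \sum_(p <- s) p.1 * character p.2.1 p.2.2 T.

Lemma character_sum_eigen s : exists n (c : 'I_n -> C) (f : 'I_n -> X -> C),
  (forall i, eigenfunction (f i)) /\
  forall T, character_sum s T = \sum_(i < n) c i * f i T.
Proof.
pose x0 : C * (nat * int) := (0, (0%N, 0)).
exists (size s), (fun i => (nth x0 s i).1),
  (fun i => character (nth x0 s i).2.1 (nth x0 s i).2.2).
split=> [i|T]; first exact: character_eigen.
by rewrite /character_sum (big_nth x0) big_mkord.
Qed.

(** The cosine of a real number is half the sum of the exponentials [exp (i x)]
and [exp (- i x)]. *)
Lemma harmonic_character t : exists s, forall T,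
  Complex (harmonic_term j0 G t T) 0 = character_sum s T.
Proof.
case: t => [[[a phi] n] q].
exists [:: (Complex (a / 2 * cos phi) (a / 2 * sin phi), (n, q));
           (Complex (a / 2 * cos phi) (- (a / 2 * sin phi)), (n, - q))] => T.
rewrite /character_sum !big_cons big_nil addr0 /character /= intrN mulNr.
rewrite cosN sinN cosD.
set x := q%:~R * _; clearbody x.
by apply/eqP; rewrite eq_complex /=; apply/andP; split; apply/eqP; field.
Qed.

Lemma trigpoly_character s : exists s', forall T,
  Complex (trigpoly s T) 0 = character_sum s' T.
Proof.
elim: s => [|t s [s' IH]].
  by exists [::] => T; rewrite /trigpoly /character_sum !big_nil.
have [s1 E1] := harmonic_character t; exists (s1 ++ s') => T.
rewrite trigpoly_cons /character_sum big_cat -/(character_sum s1 T).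
rewrite -/(character_sum s' T) -IH -E1.
by apply/eqP; rewrite eq_complex /= addr0 !eqxx.
Qed.

Lemma complex_trigpoly_character s s' : exists s'', forall T,
  Complex (trigpoly s T) (trigpoly s' T) = character_sum s'' T.
Proof.
have [s1 E1] := trigpoly_character s; have [s2 E2] := trigpoly_character s'.
exists (s1 ++ [seq (Complex 0 1 * p.1, p.2) | p <- s2]) => T.
rewrite /character_sum big_cat big_map /= -/(character_sum s1 T).
rewrite (eq_bigr (fun p => Complex 0 1 * (p.1 * character p.2.1 p.2.2 T)));
  last first.
  by move=> p _; rewrite mulrA.
rewrite -big_distrr /= -/(character_sum s2 T) -E1 -E2.
by apply/eqP; rewrite eq_complex /=; apply/andP; split; apply/eqP; ring.
Qed.

Lemma normc_sq (z : C) : Normc.normc z ^+ 2 = complex.Re z ^+ 2 + complex.Im z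
  ^+ 2.
Proof. by case: z => a b; rewrite /= sqr_sqrtr // addr_ge0 // sqr_ge0. Qed.

Lemma normc_ge0 (z : C) : 0 <= Normc.normc z.
Proof. by case: z => a b; exact: sqrtr_ge0. Qed.

Section Invariant.
Variable mu : probability X R.
Hypothesis mu_inv : translation_invariant mu.

Let mu_fin : (mu setT < +oo)%E.
Proof. by rewrite probability_setT ltry. Qed.

Let Rint_cst (c : R) : \int[mu]_T cst c T = c.
Proof.
rewrite Rintegral_cst // [X in fine X](_ : _ = 1%E) ?mulr1 //.
exact: probability_setT.
Qed.

Lemma cLnorm2_sq (g : X -> C) :
  (cLnorm2 mu g `^ 2 = \int[mu]_T ((Normc.normc (g T)) ^+ 2)%:E)%E.
Proof.
rewrite /cLnorm2 poweR_Lnorm //; apply: eq_integral => T _.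
by rewrite abse_EFin ger0_norm ?normc_ge0 // poweR_EFin powR_mulrn ?normc_ge0.
Qed.

Lemma trigpolys_dense (f : X -> R) : measurable_fun setT f ->
  (sq_integral mu f < +oo)%E -> approximable mu (trigpolys j0 G) f.
Proof.
apply: (approximable_all (trigpolys_algebra constF j0 liftG)).
by move=> E; exact: (approx_set_all constF liftG mu_fin mu_inv coincF).
Qed.

(** The real and imaginary parts are approximated separately, each with half of
the squared error. *)
Lemma pure_point : pure_point_spectrum mu.
Proof.
move=> g [mRe mIm] gfin e e0.
have sqfin : (\int[mu]_T ((Normc.normc (g T)) ^+ 2)%:E < +oo)%E.
  by rewrite -cLnorm2_sq poweR_lty.
have mN : measurable_fun setT (fun T : X => ((Normc.normc (g T)) ^+ 2)%:E : \bar
  R).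
  apply/measurable_EFinP.
  have -> : (fun T => Normc.normc (g T) ^+ 2) =
     (fun T => complex.Re (g T) ^+ 2 + complex.Im (g T) ^+ 2).
    by apply/funext => T; exact: normc_sq.
  by apply: measurable_funD; exact: measurable_funX.
have part (f : X -> R) : measurable_fun setT f ->
    (forall T, f T ^+ 2 <= Normc.normc (g T) ^+ 2) -> (sq_integral mu f <
      +oo)%E.
  move=> mf fg; apply: le_lt_trans sqfin; apply: ge0_le_integral => //.
  - by move=> T _; rewrite lee_fin sqr_ge0.
  - exact: measurable_sq.
  - by move=> T _; rewrite lee_fin.
have e2 : 0 < e ^+ 2 / 2 by rewrite divr_gt0 // exprn_gt0.
have [|_ /(_ _ e2)[_ [s ->] us]] := trigpolys_dense mRe.
  by apply: part => // T; rewrite normc_sq lerDl sqr_ge0.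
have [|_ /(_ _ e2)[_ [s' ->] vs]] := trigpolys_dense mIm.
  by apply: part => // T; rewrite normc_sq lerDr sqr_ge0.
have [s'' E] := complex_trigpoly_character s s'.
have [n [c [f [ef fE]]]] := character_sum_eigen s''.
exists n, c, f; split => //.
have m1 : measurable_fun setT (fun T : X => complex.Re (g T) - trigpoly s T).
  by apply: measurable_funB => //;
    have [_ _ _ h _] := trigpolys_algebra constF j0 liftG; apply: h; exists s.
have m2 : measurable_fun setT (fun T : X => complex.Im (g T) - trigpoly s' T).
  by apply: measurable_funB => //;
    have [_ _ _ h _] := trigpolys_algebra constF j0 liftG; apply: h; exists s'.
have lt2 : (cLnorm2 mu (fun T => g T - \sum_(i < n) c i * f i T)%R `^ 2 < (e ^+
  2)%:E)%E.
  rewrite cLnorm2_sq.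
  rewrite (eq_integral (fun T => ((complex.Re (g T) - trigpoly s T) ^+ 2)%:E +
    ((complex.Im (g T) - trigpoly s' T) ^+ 2)%:E)%E); last first.
    move=> T _; rewrite -fE -E normc_sq; case: (g T) => a b /=.
    by rewrite EFinD.
  rewrite ge0_integralD //; last 4 first.
  - by move=> T _; rewrite lee_fin sqr_ge0.
  - exact: measurable_sq.
  - by move=> T _; rewrite lee_fin sqr_ge0.
  - exact: measurable_sq.
  have -> : (e ^+ 2)%:E = ((e ^+ 2 / 2)%:E + (e ^+ 2 / 2)%:E)%E.
    by rewrite -EFinD -splitr.
  exact: lteD.
rewrite ltNge; apply/negP => eL; move: lt2; apply/negP; rewrite -leNgt.
have -> : (e ^+ 2)%:E = (e%:E `^ 2)%E by rewrite poweR_EFin powR_mulrn // ltW.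
apply: gt0_ler_poweR => //; rewrite in_itv /= leey andbT.
  by rewrite lee_fin ltW.
exact: Lnorm_ge0.
Qed.

Lemma measurable_hull_shift v : measurable_fun setT (hull_shift v : X -> X).
Proof.
apply: (measurability _ (erefl : @measurable _ X = <<s @open (tiling_space F)
  >>)).
move=> _ [A oA <-]; rewrite setTI; apply: open_measurable_tiling.
by move/continuousP: (@continuous_hull_shift R F 0 v) => H; exact: (H _ oA).
Qed.

Lemma bounded_integrable (f : X -> R) (M : R) : measurable_fun setT f ->
  (forall T, `|f T| <= M) -> mu.-integrable setT (EFin \o f).
Proof.
move=> mf fM; apply: measurable_bounded_integrable => //.
exists M; split; first exact: num_real.
by move=> M' MM' T _ /=; exact: le_trans (fM T) (ltW MM').
Qed.

Lemma trigpoly_integrable s : mu.-integrable setT (EFin \o trigpoly s).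
Proof.
have [_ _ _ hm hb] := trigpolys_algebra constF j0 liftG.
have [M fM] : exists M, forall T, `|trigpoly s T| <= M by apply: hb; exists s.
by apply: bounded_integrable fM; apply: hm; exists s.
Qed.

Lemma harmonic_integrable t : mu.-integrable setT (EFin \o harmonic_term j0 G
  t).
Proof.
have := trigpoly_integrable [:: t]; congr (_.-integrable _ _).
by apply/funext => T /=; rewrite trigpoly_cons /trigpoly big_nil addr0.
Qed.

Lemma Rintegral_shift (f : X -> R) M v : measurable_fun setT f ->
  (forall T, `|f T| <= M) ->
  \int[mu]_T f (hull_shift v T) = \int[mu]_T f T.
Proof.
move=> mf fM; rewrite /Rintegral; congr fine.
have mf' : measurable_fun setT (EFin \o f) by exact/measurable_EFinP.
have intv : mu.-integrable (hull_shift v @^-1` setT) ((EFin \o f) \o hull_shift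
  v).
  rewrite preimage_setT; apply: (bounded_integrable (M := M)) => //.
  exact: measurableT_comp mf (measurable_hull_shift v).
have := integral_pushforward (measurable_hull_shift v) mf' intv measurableT.
rewrite preimage_setT => <-; apply: eq_measure_integral => [|mh A mA _].
  exact: measurable_hull_shift.
by rewrite /pushforward; apply: mu_inv.
Qed.

(** Translation by [lvl_len n / (2 q)] changes the argument of the cosine by
[pi]. *)
Lemma Rintegral_harmonic a phi n q :
  \int[mu]_T harmonic_term j0 G (a, phi, n, q) T = if q == 0 then a * cos phi
    else 0.
Proof.
case: eqP => [->|/eqP q0].
  under eq_Rintegral do rewrite /= mul0r add0r.
  exact: Rint_cst.
have l0 : lvl_len n != 0 by rewrite gt_eqF // lvl_len_gt0.
have qR0 : (q%:~R : R) != 0 by rewrite intr_eq0.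
(* Half of the period of the harmonic. *)
pose v := lvl_len n / (2 * q%:~R).
have flip T : harmonic_term j0 G (a, phi, n, q) (hull_shift (- v) T) =
    (-1) * harmonic_term j0 G (a, phi, n, q) T.
  have [z ze] := angle_shift n T v; rewrite /= ze.
  have -> : q%:~R * (angle n T + 2 * pi * (v / lvl_len n) + 2 * pi * z%:~R) +
    phi =
     (q%:~R * angle n T + phi + pi) + 2 * pi * (q * z)%:~R.
    by rewrite intrM /v; field; rewrite l0 qR0.
  by rewrite cos_2pi_int cosDpi; ring.
have intf := harmonic_integrable (a, phi, n, q).
have hM T : `|harmonic_term j0 G (a, phi, n, q) T| <= `|a|.
  by rewrite /= normrM ler_piMr // cos_max.
have := Rintegral_shift (- v) (measurable_harmonic constF j0 liftG _) hM.
under eq_Rintegral do rewrite flip.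
rewrite RintegralZl //; lra.
Qed.

(** The value does not involve the measure: it is the same for all the invariant
probabilities. *)
Lemma Rintegral_trigpoly s :
  \int[mu]_T trigpoly s T = \sum_(t <- s)
    (let: (a, phi, n, q) := t in if q == 0 then a * cos phi else 0).
Proof.
elim: s => [|[[[a phi] n] q] s IH].
  under eq_Rintegral do rewrite /trigpoly big_nil.
  by rewrite big_nil; exact: Rint_cst.
rewrite big_cons -IH -(Rintegral_harmonic a phi n q) -RintegralD //.
- by apply: eq_Rintegral => T _; rewrite trigpoly_cons.
- exact: harmonic_integrable.
- exact: trigpoly_integrable.
Qed.

(** Mean square closeness gives closeness in mean, from
[`|x| <= e + x ^+ 2 / e]. *)
Lemma Rintegral_indic_close (E : set X) s e : measurable E -> 0 < e ->
  (sq_integral mu (fun T => \1_E T - trigpoly s T)%R < (e ^+ 2)%:E)%E ->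
  `|fine (mu E) - \int[mu]_T trigpoly s T| <= 2 * e.
Proof.
move=> mE e0 sq.
have mI : measurable_fun setT (\1_E : X -> R) by exact: measurable_indic.
have iI : mu.-integrable setT (EFin \o (\1_E : X -> R)).
  by apply: bounded_integrable (indic_le1 R E).
have it := trigpoly_integrable s.
have mt : measurable_fun setT (trigpoly s).
  by have [_ _ _ h _] := trigpolys_algebra constF j0 liftG; apply: h; exists s.
have -> : fine (mu E) = \int[mu]_T \1_E T.
  by rewrite /Rintegral integral_indic // setIT.
rewrite -RintegralB //.
have iB : mu.-integrable setT (EFin \o (fun T => \1_E T - trigpoly s T)).
  exact: (integrableB measurableT iI it).
apply: le_trans (le_normr_Rintegral _ iB) _ => //.
have mB : measurable_fun setT (fun T => \1_E T - trigpoly s T).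
  exact: measurable_funB.
have isq : mu.-integrable setT (fun T => ((\1_E T - trigpoly s T) ^+ 2)%:E).
  apply/integrableP; split; first exact: measurable_sq.
  under eq_integral do rewrite gee0_abs ?lee_fin ?sqr_ge0 //.
  by apply: lt_trans sq _; rewrite ltry.
have isq' : mu.-integrable setT (EFin \o (fun T => e^-1 * (\1_E T - trigpoly s
  T) ^+ 2)).
  exact: (integrableZl measurableT e^-1 isq).
have ic : mu.-integrable setT (EFin \o (cst e : X -> R)).
  by apply: (@bounded_integrable _ `|e|) => //.
apply: (@le_trans _ _ (\int[mu]_T (cst e T + e^-1 * (\1_E T - trigpoly s T) ^+
  2))).
  apply: le_Rintegral => //.
  - exact: (integrable_norm iB).
  - exact: (integrableD measurableT ic isq').
  move=> T _ /=; set x := _ - _.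
  have [xe|xe] := leP `|x| e.
    by apply: le_trans xe _; rewrite lerDl mulr_ge0 ?sqr_ge0 // invr_ge0 ltW.
  apply: (@le_trans _ _ (e^-1 * x ^+ 2)); last by rewrite lerDr ltW.
  rewrite mulrC ler_pdivlMr // -[x ^+ 2]real_normK ?num_real // expr2.
  by rewrite ler_pM2l ?(lt_trans e0 xe) // ltW.
rewrite RintegralD // Rint_cst.
rewrite RintegralZl // mulrDl mul1r lerD2l mulrC ler_pdivrMr // -expr2.
rewrite /Rintegral -/(sq_integral mu _) -lee_fin fineK; first exact: ltW.
rewrite ge0_fin_numE ?sq_integral_ge0 //; exact: lt_trans sq (ltry _).
Qed.

End Invariant.

(** Density is applied to the measure [mu + nu], which is finite and invariant,
so that one trigonometric polynomial approximates the indicator in mean square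
for both measures at once. Both give that polynomial the same integral. *)
Lemma invariant_unique (mu nu : probability X R) :
  translation_invariant mu -> translation_invariant nu ->
  forall E, measurable E -> nu E = mu E.
Proof.
move=> mi ni E mE.
pose la : {measure set X -> \bar R} := measure_add mu nu.
have laE (A : set X) : la A = (mu A + nu A)%E by exact: (measure_addE mu nu A).
have la_fin : (la setT < +oo)%E.
  by rewrite laE !probability_setT -EFinD ltry.
have la_inv (v : R) (A : set X) : measurable A ->
    la (hull_shift v @^-1` A) = la A.
  by move=> mA; rewrite !laE mi // ni.
have [_ aE] := approx_set_all constF liftG la_fin la_inv coincF mE.
suff : fine (nu E) = fine (mu E).
  move=> fE; rewrite -[LHS]fineK ?fin_num_measure // fE fineK ?fin_num_measure
    //.
apply/eqP; rewrite -subr_eq0 -normr_le0; apply/ler_addgt0Pr => e e0;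
  rewrite add0r.
have e4 : 0 < e / 4 by rewrite divr_gt0.
have [_ [s ->] us] := aE.2 _ (exprn_gt0 2 e4).
have mB : measurable_fun setT (fun T => \1_E T - trigpoly s T).
  apply: measurable_funB; first exact: measurable_indic.
  by have [_ _ _ h _] := trigpolys_algebra constF j0 liftG; apply: h; exists s.
have sqE : sq_integral la (fun T => \1_E T - trigpoly s T) =
   (sq_integral mu (fun T => \1_E T - trigpoly s T)%R +
    sq_integral nu (fun T => \1_E T - trigpoly s T)%R)%E.
  rewrite /sq_integral ge0_integral_measure_add //.
  - by move=> T _; rewrite lee_fin sqr_ge0.
  - exact: measurable_sq.
have h1 := Rintegral_indic_close (mu := mu) mE e4 (s := s).
have h2 := Rintegral_indic_close (mu := nu) mE e4 (s := s).
rewrite sqE in us.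
have {}h1 := h1 (le_lt_trans (leeDl _ (sq_integral_ge0 nu _)) us).
have {}h2 := h2 (le_lt_trans (leeDr _ (sq_integral_ge0 mu _)) us).
rewrite (Rintegral_trigpoly mi) in h1; rewrite (Rintegral_trigpoly ni) in h2.
move: h1 h2; set I := \sum_(_ <- _) _; rewrite !ler_norml; lra.
Qed.

End SpectrumTheorems.

(** * The odometer and the words that it traces *)

Section UniformProb.
Context {R : realType}.

Lemma uniform_prob_lt (a b c : R) (ab : a < b) : a <= c <= b ->
  uniform_prob ab [set x | x < c] = ((c - a) / (b - a))%:E.
Proof.
move=> /andP[ac cb]; rewrite /uniform_prob integral_uniform_pdf.
have -> : [set x | x < c] `&` `[a, b] = `[a, c[%classic.
  apply/seteqP; split => x /=; rewrite !in_itv /=.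
    by move=> [-> /andP[->]].
  by move=> /andP[-> xc]; split=> //; rewrite (le_trans (ltW xc)).
rewrite (eq_integral (fun=> ((b - a)^-1)%:E)); last first.
  move=> x; rewrite inE /= in_itv /= /uniform_pdf => /andP[-> xc].
  by rewrite (le_trans (ltW xc)).
rewrite integral_cst //= lebesgue_measure_itv /= lte_fin.
case: ltgtP ac => // [ac _|-> _]; last by rewrite mule0 subrr mul0r.
by rewrite -EFinD -EFinM mulrC.
Qed.

Lemma measurable_lt (c : R) : measurable [set x : R | x < c].
Proof.
have -> : [set x : R | x < c] = `]-oo, c[%classic.
  by apply/seteqP; split => x /=; rewrite in_itv.
exact: measurable_itv.
Qed.

Lemma set_itv_lt (c d : R) :
  [set x : R | c <= x < d] = [set x | x < d] `\` [set x | x < c].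
Proof.
apply/seteqP; split => x /=.
  by move=> /andP[cx xd]; split => //; apply/negP; rewrite -leNgt.
by move=> [-> /negP]; rewrite -leNgt => ->.
Qed.

Lemma measurable_co (c d : R) : measurable [set x : R | c <= x < d].
Proof. by rewrite set_itv_lt; apply: measurableD; exact: measurable_lt. Qed.

Lemma uniform_prob_co (a b c d : R) (ab : a < b) : a <= c -> c <= d -> d <= b ->
  uniform_prob ab [set x | c <= x < d] = ((d - c) / (b - a))%:E.
Proof.
move=> ac cd db; rewrite set_itv_lt measureD //=; try exact: measurable_lt.
  rewrite setIidr; last by move=> x /= xc; exact: lt_le_trans cd.
  rewrite !uniform_prob_lt; last 2 first.
  - by rewrite ac (le_trans cd).
  - by rewrite (le_trans ac).
  by rewrite -EFinB -mulrBl; congr ((_ / _)%:E); ring.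
by rewrite uniform_prob_lt ?ltry // (le_trans ac).
Qed.

Lemma probability_setI_full d (T : measurableType d) (P : probability T R)
  (A B : set T) : measurable A -> measurable B -> P B = 1%E -> P (A `&` B) = P
    A.
Proof.
move=> mA mB PB.
have PC : P (~` B) = 0%E by rewrite probability_setC // PB -EFinB subrr.
have E : A = (A `&` B) `|` (A `&` ~` B) by rewrite -setIUr setUv setIT.
rewrite [in RHS]E measureU //; last 3 first.
- exact: measurableI.
- by apply: measurableI => //; exact: measurableC.
- by rewrite setIACA setICr setI0.
rewrite [X in (_ + X)%E](_ : _ = 0%E) ?adde0 //.
apply: (@subset_measure0 _ _ _ P _ (~` B)) => //.
- by apply: measurableI => //; exact: measurableC.
- exact: measurableC.
Qed.

End UniformProb.

Section Odometer.
Context {R : realType} (F : fusion_rule R).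
Hypothesis constF : constant_length F.
Variable j0 : forall N, 'I_(ntypes F N).
Local Notation Q := (lvl_size j0).
Local Notation K := (arity j0).

Let QS n : Q n.+1 = (K n * Q n)%N. Proof. exact: lvl_sizeS. Qed.
Let Q_gt0 n : (0 < Q n)%N. Proof. exact: lvl_size_gt0. Qed.
Let K_gt0 n : (0 < K n)%N. Proof. exact: arity_gt0. Qed.

(** The digits of [i] in the mixed radix [K 0, K 1, ...] are read in the reverse
order. The leading digits of a real number then give the least significant
digits of the odometer, so that longer expansions refine the residue. *)
Fixpoint rev_digits n (i : nat) : nat :=
  if n is n'.+1 then (rev_digits n' (i %/ K n') + (i %% K n') * Q n')%N else
    0%N.

Lemma rev_digits_lt n i : (rev_digits n i < Q n)%N.
Proof.
elim: n i => [|n IH] i //=; rewrite QS.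
apply: (@leq_trans ((i %% K n).+1 * Q n)).
  by rewrite mulSn ltn_add2r.
by rewrite leq_mul2r ltn_mod K_gt0 orbT.
Qed.

Lemma rev_digits_inj n i j : (i < Q n)%N -> (j < Q n)%N ->
  rev_digits n i = rev_digits n j -> i = j.
Proof.
elim: n i j => [|n IH] i j.
  by rewrite lvl_size0 !ltnS !leqn0 => /eqP -> /eqP ->.
rewrite QS => iQ jQ /= e.
have dE x y : (x < Q n)%N -> ((x + y * Q n) %/ Q n = y)%N.
  by move=> xQ; rewrite addnC divnMDl // divn_small // addn0.
have em : (i %% K n = j %% K n)%N.
  by rewrite -(dE _ (i %% K n)%N (rev_digits_lt n (i %/ K n))) e dE
    ?rev_digits_lt.
move: e; rewrite em => /addIn /IH ed.
rewrite (divn_eq i (K n)) (divn_eq j (K n)) em ed // ltn_divLR // mulnC //.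
Qed.

Lemma sum_rev_digits n (P : pred nat) :
  (\sum_(i < Q n) P (rev_digits n i) = \sum_(i < Q n) P i)%N.
Proof.
pose h (i : 'I_(Q n)) := Ordinal (rev_digits_lt n i).
have hinj : injective h.
  by move=> i j /(congr1 val) /= /rev_digits_inj e; apply: val_inj; exact: e.
by rewrite [RHS](reindex_inj hinj).
Qed.

Definition radix_index n (U : R) : nat := Num.trunc (U * (Q n)%:R).

(** The slot at level [n] coded by a number [U] of the unit interval: its first
[n] digits in mixed radix, read as the residue modulo [Q n] of a point of the
odometer. *)
Definition odometer n (U : R) : nat := rev_digits n (radix_index n U).

Lemma radix_index_div n U : (radix_index n.+1 U %/ K n)%N = radix_index n U.
Proof.
suff h m : (m < radix_index n.+1 U %/ K n)%N = (m < radix_index n U)%N.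
  have := h (radix_index n U); have := h (radix_index n.+1 U %/ K n)%N;
    rewrite !ltnn.
  by case: ltngtP.
have KR : 0 < (K n)%:R :> R by rewrite ltr0n.
rewrite leq_divRL // /radix_index QS truncn_gt_nat -[(m.+1 * K n)%N]prednK
  ?muln_gt0 ?K_gt0 //.
rewrite truncn_gt_nat prednK ?muln_gt0 ?K_gt0 // !natrM mulrCA [_ * (K
  n)%:R]mulrC.
by rewrite ler_pM2l.
Qed.

(** The slot at level [n.+1] is that of level [n] inside the [n]-supertile whose
rank is the next digit, as it must be for the slots of a tiling. *)
Lemma odometerS n U :
  odometer n.+1 U = (odometer n U + (radix_index n.+1 U %% K n) * Q n)%N.
Proof. by rewrite /odometer /= radix_index_div. Qed.

Let QR n : 0 < (Q n)%:R :> R. Proof. by rewrite ltr0n. Qed.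

Lemma radix_index_eq0 n : [set U | radix_index n U = 0%N] = [set U | U < (Q
  n)%:R^-1].
Proof.
apply/seteqP; split => U /=; rewrite -[ltRHS]mul1r ltr_pdivlMr //
  -(truncn_le_nat _ 0) -/(radix_index n U); first by move=> ->.
by rewrite leqn0 => /eqP.
Qed.

Lemma radix_index_eqS n i : [set U | radix_index n U = i.+1] =
  [set U | i.+1%:R / (Q n)%:R <= U < i.+2%:R / (Q n)%:R].
Proof.
apply/seteqP; split => U /=; rewrite ler_pdivrMr // ltr_pdivlMr //
  -truncn_le_nat -truncn_gt_nat -/(radix_index n U); first by move=> ->;
    rewrite leqnn.
by move=> h; apply/eqP; rewrite eqn_leq andbC.
Qed.

Lemma measurable_radix_index n i : measurable [set U : R | radix_index n U = i].
Proof.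
case: i => [|i]; rewrite ?radix_index_eq0 ?radix_index_eqS;
  first exact: measurable_lt.
exact: measurable_co.
Qed.

Local Notation P1 := (uniform_prob (@ltr01 R)).

Lemma measure_radix_index n i : (i < Q n)%N -> P1 [set U | radix_index n U = i]
  = ((Q n)%:R^-1)%:E.
Proof.
move=> iQ; have q0 : 0 < (Q n)%:R :> R by rewrite ltr0n.
case: i iQ => [|i] iQ.
  rewrite radix_index_eq0 uniform_prob_lt ?subr0 ?divr1 //.
  by rewrite invr_ge0 ltW //= invf_le1 // ler1n.
rewrite radix_index_eqS uniform_prob_co; last 3 first.
- by rewrite divr_ge0.
- by rewrite ler_pM2r ?invr_gt0 // ler_nat.
- by rewrite ler_pdivrMr // mul1r ler_nat.
by rewrite subr0 divr1 -mulrBl -[i.+2%:R]natr1 addrAC subrr add0r mul1r.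
Qed.

Lemma measurable_odometer n (P : pred nat) : measurable [set U : R | P (odometer
  n U)].
Proof. exact: (measurable_index (measurable_radix_index n) (fun i => P
  (rev_digits n i))). Qed.

(** The intervals of length [1 / Q n] are equally likely, and the reversal of
digits permutes them. *)
Lemma measure_odometer n (P : pred nat) : P1 [set U | P (odometer n U)] =
  ((\sum_(i < Q n) P i)%N%:R / (Q n)%:R)%:E.
Proof.
have mP P' := @measure_index_lt _ _ R P1 (radix_index n) (Q n) _
  (measurable_radix_index n)
  (@measure_radix_index n) P' _ (leqnn (Q n)).
have full : P1 [set U | (radix_index n U < Q n)%N] = 1%E.
  have -> : [set U | (radix_index n U < Q n)%N] = [set U | (radix_index n U < Q
    n)%N && predT (radix_index n U)].
    by apply/seteqP; split => U /=; rewrite andbT.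
  rewrite mP (eq_bigr (fun=> 1%N)) ?sum1_card ?card_ord // -EFinM divff //.
  by rewrite pnatr_eq0 -lt0n.
rewrite -(probability_setI_full _ _ full); last 2 first.
- exact: measurable_odometer.
- exact: (measurable_index (measurable_radix_index n) (fun i => (i < Q n)%N)).
rewrite EFinM -sum_rev_digits -(mP (fun i => P (rev_digits n i))); congr (P1 _).
by apply/seteqP; split => U /=; [move=> [-> ->]|move=> /andP[-> ->]].
Qed.

(** The tilings with slots [odometer n U] at all levels [n] must have prototile
[a] at cell [d]. *)
Definition traced (U : R) (d : int) a : Prop :=
  exists n, coincides j0 n ((odometer n U)%:Z + d) a.

(** A coincident position of an [n]-supertile is a coincident position of every
larger supertile that contains it. *)
Lemma coincides_mono U d a n m : (n <= m)%N ->
  coincides j0 n ((odometer n U)%:Z + d) a -> coincides j0 m ((odometer m U)%:Z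
    + d) a.
Proof.
move=> nm; rewrite -(subnK nm); elim: (m - n)%N => [//|k IH] /IH c.
rewrite addSn odometerS.
have e : (radix_index (k + n).+1 U %% K (k + n) < K (k + n))%N by rewrite
  ltn_mod.
have := coincides_step constF e c; congr (is_true (coincides _ _ _ _)).
by rewrite PoszD addrAC.
Qed.

Lemma traced_uniq U d a b : traced U d a -> traced U d b -> a = b.
Proof.
move=> [n na] [m mb].
apply: (coincides_uniq (coincides_mono (leq_maxl n m) na)).
exact: coincides_mono (leq_maxr n m) mb.
Qed.

Hypothesis coincF : mostly_coincident j0.
Hypothesis unbounded : forall B, exists N, (B <= Q N)%N.

Definition traceable : set R := [set U | forall d, exists a, traced U d a].

Let bad (d : int) : set R :=
  \bigcap_n [set U | ~~ coincident j0 n ((odometer n U)%:Z + d)].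

Let measurable_bad d : measurable (bad d).
Proof.
apply: bigcap_measurable => [|n _]; first by exists 0%N.
exact: (measurable_odometer n (fun s => ~~ coincident j0 n (s%:Z + d))).
Qed.

Let traceableE : traceable = ~` \bigcup_n (bad n%:Z `|` bad (Negz n)).
Proof.
have tr d U : ~ bad d U -> exists a, traced U d a.
  move=> /existsNP[n /not_implyP[_ /negP]]; rewrite negbK => /existsP[a an].
  by exists a, n.
have trN d U : (exists a, traced U d a) -> ~ bad d U.
  move=> [a [n an]] /(_ n I) /= /negP; apply.
  by apply/existsP; exists a.
apply/seteqP; split => U /= h; first by move=> [n _ []]; apply: trN; exact: h.
by move=> [] n; apply: tr => b; apply: h; exists n => //; [left|right].
Qed.

Lemma measurable_traceable : measurable traceable.
Proof.
rewrite traceableE; apply: measurableC; apply: bigcup_measurable => n _.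
by apply: measurableU; exact: measurable_bad.
Qed.

(** The cell [d] is left undetermined only if position [odometer n U + d] is not
coincident at any level [n], which [mostly_coincident] makes unlikely. *)
Lemma measure_traceable : P1 traceable = 1%E.
Proof.
have bad0 d : P1 (bad d) = 0%E.
  apply/eqP; rewrite eq_le measure_ge0 andbT; apply/lee_addgt0Pr => e e0.
  have [n ne] := coincF d e0; rewrite add0e.
  apply: (@le_trans _ _ (P1 [set U | ~~ coincident j0 n ((odometer n U)%:Z +
    d)])).
    apply: le_measure; rewrite ?inE; last by move=> U; apply.
      exact: measurable_bad.
    exact: (measurable_odometer n (fun s => ~~ coincident j0 n (s%:Z + d))).
  rewrite (measure_odometer n (fun s => ~~ coincident j0 n (s%:Z + d))) lee_fin.
  by rewrite ler_pdivrMr.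
have mU : measurable (\bigcup_n (bad n%:Z `|` bad (Negz n))).
  by apply: bigcup_measurable => n _; apply: measurableU; exact: measurable_bad.
rewrite traceableE probability_setC // [X in (_ - X)%E](_ : _ = 0%E) ?sube0 //.
apply: measure_negligible => //; apply: negligible_bigcup => n.
by apply: negligibleU; apply/negligibleP;
  (exact: measurable_bad || exact: bad0).
Qed.

Definition trace_match (c : seq (int * 'I_(ntypes F 0))) : set R :=
  [set U | forall u, u \in c -> traced U u.1 u.2].

Let match_at (n : nat) c (s : int) : bool :=
  all (fun u : int * 'I_(ntypes F 0) => coincides j0 n (s + u.1) u.2) c.

Let trace_matchE c : trace_match c = \bigcup_n [set U | match_at n c (odometer n
  U)].
Proof.
apply/seteqP; split => U /=; last first.
  by move=> [n _ /allP h] u uc; exists n; exact: h.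
elim: c => [|u c IH] h; first by exists 0%N.
have [n _ hn] : (\bigcup_n [set U | match_at n c (odometer n U)]) U.
  by apply: IH => v vc; apply: h; rewrite inE vc orbT.
have [m hm] := h u (mem_head _ _); exists (maxn n m) => //=.
rewrite (coincides_mono (leq_maxr n m) hm) /=; apply/allP => v vc.
by apply: (coincides_mono (leq_maxl n m)); exact: (allP hn).
Qed.

Let measurable_match_at n c : measurable [set U | match_at n c (odometer n U)].
Proof. exact: (measurable_odometer n (fun s => match_at n c s%:Z)). Qed.

Lemma measurable_trace_match c : measurable (trace_match c).
Proof. by rewrite trace_matchE; exact: bigcup_measurable. Qed.

Let cvg_match c :
  (window_count (match_at n c) (Q n))%:R / (Q n)%:R @[n --> \oo] -->
  fine (P1 (trace_match c)).
Proof.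
have nd : nondecreasing_seq (fun n => [set U | match_at n c (odometer n U)]).
  move=> n m nm; apply/subsetPset => U /= /allP h; apply/allP => u uc.
  by apply: (coincides_mono nm); exact: h.
have := nondecreasing_cvg_mu (mu := P1) (measurable_match_at ^~ c)
  (bigcup_measurable (fun n _ => measurable_match_at n c)) nd.
rewrite -trace_matchE => cv.
have fin : P1 (trace_match c) \is a fin_num.
  by apply: fin_num_measure; exact: measurable_trace_match.
have {cv} : (fun n => P1 [set U | match_at n c (odometer n U)]) @ \oo -->
    (fine (P1 (trace_match c)))%:E by rewrite fineK.
move/fine_cvgP => [_]; rewrite /comp.
have -> // : (fun n => fine (P1 [set U | match_at n c (odometer n U)])) =
  (fun n => (window_count (match_at n c) (Q n))%:R / (Q n)%:R).
apply/funext => n.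
by rewrite (measure_odometer n (fun s => match_at n c s%:Z)).
Qed.

Definition shift_constraints (k : int) (c : seq (int * 'I_(ntypes F 0))) :=
  [seq (u.1 + k, u.2) | u <- c].

Let stationary1 c : P1 (trace_match (shift_constraints 1 c)) = P1 (trace_match
  c).
Proof.
have fin c' : P1 (trace_match c') \is a fin_num.
  by apply: fin_num_measure; exact: measurable_trace_match.
rewrite -(fineK (fin c)) -(fineK (fin (shift_constraints 1 c))); congr EFin.
have cv := @cvg_match c; have cv1 := @cvg_match (shift_constraints 1 c).
apply/eqP; rewrite -subr_eq0 -normr_le0; apply/ler_addgt0Pr => e e0;
  rewrite add0r.
have [B BP] := unbounded (Num.trunc (3 / e)).+1.
have e3 : 0 < e / 3 by rewrite divr_gt0.
near \oo => n.
have h1 : `|fine (P1 (trace_match c)) -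
    (window_count (match_at n c) (Q n))%:R / (Q n)%:R| < e / 3.
  by near: n; move/cvgrPdist_lt: cv; exact.
have h2 : `|fine (P1 (trace_match (shift_constraints 1 c))) -
    (window_count (match_at n (shift_constraints 1 c)) (Q n))%:R / (Q n)%:R| < e
      / 3.
  by near: n; move/cvgrPdist_lt: cv1; exact.
have Bn : (B <= n)%N by near: n; exists B.
have Qn : (Q n)%:R^-1 < e / 3.
  rewrite -[ltRHS]invrK ltf_pV2 ?posrE ?invr_gt0 // invf_div.
  apply: lt_le_trans (_ : (Num.trunc (3 / e)).+1%:R <= _);
    first exact: truncnS_gt.
  rewrite ler_nat; apply: leq_trans BP _; exact: lvl_size_mono.
have shE : window_count (match_at n (shift_constraints 1 c)) (Q n) =
   window_count (fun s => match_at n c (s + 1)) (Q n).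
  apply: eq_bigr => s _; congr nat_of_bool; rewrite /match_at all_map.
  by apply: eq_all => u /=; rewrite addrA addrAC.
have := window_count_shift1 (match_at n c) (Q n); rewrite -shE => w.
have : `|(window_count (match_at n (shift_constraints 1 c)) (Q n))%:R / (Q n)%:R
  -
   (window_count (match_at n c) (Q n))%:R / (Q n)%:R| <= (Q n)%:R^-1 :> R.
  rewrite -mulrBl normrM [`|_^-1|]gtr0_norm ?invr_gt0 // ler_piMl ?invr_ge0 //.
  move/(congr1 (GRing.natmul (1 : R))): w; rewrite !natrD.
  by case: (match_at _ _ _); case: (match_at _ _ _); rewrite ler_norml /=; lra.
move: h1 h2; rewrite !ltr_norml !ler_norml; lra.
Unshelve. all: by end_near. Qed.

(** The probability that a pattern matches is the limit, by monotonicity in the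
level, of its frequency among the [Q n] slots, and moving the pattern by one
changes this frequency by at most [1 / Q n]. *)
Lemma stationary k c :
  P1 (trace_match (shift_constraints k c)) = P1 (trace_match c).
Proof.
have comp k1 k2 : shift_constraints k1 (shift_constraints k2 c) =
    shift_constraints (k2 + k1) c.
  by rewrite /shift_constraints -map_comp; apply: eq_map => u /=; rewrite addrA.
elim/int_rect: k => [|n IH|n IH].
- by congr (P1 (trace_match _)); rewrite /shift_constraints -[RHS]map_id;
    apply: eq_map => -[d a] /=; rewrite addr0.
- by rewrite -IH -[RHS]stationary1 comp intS addrC.
- rewrite -IH -[LHS]stationary1 comp.
  by congr (P1 (trace_match (shift_constraints _ _))); lia.
Qed.

End Odometer.

(** * Existence of an invariant measure *)

Section Reconstruction.
Context {R : realType} (F : fusion_rule R).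
Hypothesis constF : constant_length F.
Variable j0 : forall N, 'I_(ntypes F N).
Local Notation lvl_len := (lvl_len j0).
Local Notation odometer := (@odometer R F j0).
Local Notation traced := (traced j0).
Local Notation traceable := (traceable j0).

Lemma expand0_word m (j : 'I_(ntypes F (m + 0))) : expand j = word j.
Proof.
rewrite word_expand; elim: (expand j) => //= a s IH.
by rewrite -IH.
Qed.

(** The patches of the tiling with these cells are admissible because finitely
many cells are all decided at one level [N], and then every [N]-supertile
contains them. *)
Lemma trace_hull (U p : R) : traceable U -> 0 <= p < lvl_len 0 ->
  exists T : hull F 0, hull_phase j0 T = p /\
    forall d a, hull_cell j0 T d a <-> traced U d a.
Proof.
move=> /choice[t tP] pl; have l0 := lvl_len_gt0 j0 0.
pose S : set (tile R 'I_(ntypes F 0)) :=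
  [set u | exists d : int, u = (- p + d%:~R * lvl_len 0, t d)].
have tS : is_tiling (@st_len R F 0) S.
  exact: (lattice_tiling l0 (@st_lenE R F constF j0 0)).
have inj (d e : int) : - p + d%:~R * lvl_len 0 = - p + e%:~R * lvl_len 0 -> d =
  e.
  by move=> /addrI /(mulIf (lt0r_neq0 l0)) /intr_inj.
have aS : admissible S.
  move=> x w wS; case: w => [|a w] in wS *;
    first by exists 0%N, (j0 (0 + 0)%N), 0.
  set w' := a :: w in wS *.
  have inS e : (e < size w')%N -> S (x + e%:R * lvl_len 0, nth (j0 0%N) w' e).
    move=> ew; apply: wS; change (tile_patch (@st_len R F 0) x w'
      (x + e%:R * lvl_len 0, nth (j0 0%N) w' e)).
    by apply/(tile_patchP constF j0); exists e.
  have [d [xd _]] := inS 0%N isT.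
  rewrite mul0r addr0 in xd.
  have wt e : (e < size w')%N -> nth (j0 0%N) w' e = t (d + e%:Z).
    move=> /inS[d' [e1 ->]]; congr (t _); apply: inj.
    by rewrite -e1 xd intrD mulrDl addrA.
  have /choice[n nP] : forall e : nat, exists n,
    coincides j0 n ((odometer n U)%:Z + (d + e%:Z)) (t (d + e%:Z)).
    by move=> e; exact: tP.
  pose N := \max_(e < size w') n e.
  have NP e : (e < size w')%N -> coincides j0 (N + 0) ((odometer (N + 0) U)%:Z +
    (d + e%:Z)) (t (d + e%:Z)).
    move=> ew; apply: (coincides_mono constF _ (nP e)); rewrite addn0.
    exact: (leq_bigmax (Ordinal ew)).
  (* This translation puts the left end of the supertile at [0]. *)
  pose v := p + (odometer (N + 0) U)%:R * lvl_len 0.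
  exists N, (j0 (N + 0)%N), v.
  rewrite translate_tile_patch => -[y i] /(tile_patchP constF j0)[e ew [ye ie]].
  have := NP e ew; case E : (_ + _) =>
    [m|//] /= /andP[mN /forallP/(_ (j0 (N + 0)%N))/eqP me].
  apply/(tile_patchP constF j0); exists m; rewrite expand0_word ?size_word //.
  rewrite me -ie wt //; split => //.
  rewrite ye xd /v add0r.
  have -> : m%:R = (odometer (N + 0) U)%:R + (d%:~R + e%:R) :> R.
    by rewrite [LHS]pmulrn -E !intrD !pmulrn.
  by ring.
pose T := Hull tS aS; exists T.
have hp : hull_phase j0 T = p.
  apply: (hull_phase_eq constF (j := t 0)) => //.
  by exists 0; rewrite mul0r addr0.
split => // d a; rewrite /hull_cell /cell -/(hull_phase j0 T) hp; split.
  by move=> [d' [/inj -> ->]]; exact: tP.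
by move=> da; exists d; rewrite (traced_uniq constF da (tP d)).
Qed.

End Reconstruction.

Section Existence.
Context {R : realType} (F : fusion R).
Hypothesis constF : constant_length F.
Variable j0 : forall N, 'I_(ntypes F N).
Local Notation X := (borel_tiling_space F).
Local Notation lvl_len := (lvl_len j0).
Local Notation Q := (lvl_size j0).
Local Notation traced := (traced (R := R) j0).
Local Notation traceable := (traceable (R := R) j0).
Local Notation trace_match := (trace_match (R := R) j0).
Hypothesis coincF : mostly_coincident j0.
Hypothesis unbounded : forall B, exists N, (B <= Q N)%N.

Let l0 : 0 < lvl_len 0. Proof. exact: lvl_len_gt0. Qed.

(** A fixed tiling is used outside of [trace_base], which has full measure. *)
Definition reconstruct (z : R * R) : X :=
  xget (projT1 (cid (fusion_nonempty F)))
    [set T : hull F 0 | hull_phase j0 T = z.2 /\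
      forall d a, hull_cell j0 T d a <-> traced z.1 d a].

Definition trace_base : set (R * R) :=
  traceable `*` [set p | 0 <= p < lvl_len 0].

Lemma reconstructP z : trace_base z ->
  hull_phase j0 (reconstruct z : hull F 0) = z.2 /\
  forall d a, hull_cell j0 (reconstruct z) d a <-> traced z.1 d a.
Proof.
move=> [tz pz]; rewrite /reconstruct; case: xgetP => [T _ //|].
by have [T TP] := trace_hull constF tz pz; move=> /(_ T).
Qed.

(** The phase and the cells of an actual tiling satisfy the conditions of
[trace_base], so that the choice is empty outside of it. *)
Lemma reconstructN z : ~ trace_base z ->
  reconstruct z = projT1 (cid (fusion_nonempty F)).
Proof.
move=> nz; rewrite /reconstruct; case: xgetP => [T _ [h1 h2]|//].
case: nz; split => [d|]; last by have [+ _] := hull_phaseP constF j0 T;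
  rewrite h1.
by have [a da] := hull_cell_ex constF j0 T d; exists a; apply/h2.
Qed.

Lemma measurable_trace_base : measurable trace_base.
Proof.
apply: measurableX; first exact: measurable_traceable.
exact: measurable_co.
Qed.

Lemma reconstruct_cylinder c x :
  reconstruct @^-1` (cylinder j0 c x) `&` trace_base =
  (trace_match c `&` traceable) `*` [set p | 0 <= p < lvl_len 0 /\ p < x].
Proof.
apply/seteqP; split => -[U p] /=.
  move=> [[m px] bz]; have [/= h1 h2] := reconstructP bz; case: bz => /= tU pl.
  split; last by split => //; move: px; rewrite /= h1.
  by split => // u uc; apply/h2; exact: m.
move=> [[m tU] [pl px]]; have bz : trace_base (U, p) by [].
have [/= h1 h2] := reconstructP bz; split => //; split; last by rewrite h1.
by move=> u uc; apply/h2; exact: m.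
Qed.

Lemma measurable_reconstruct : measurable_fun setT reconstruct.
Proof.
apply: (measurability _ (cylinders_generate constF j0)).
move=> _ [_ [c [x ->]] <-]; rewrite setTI.
pose T0 : X := projT1 (cid (fusion_nonempty F)).
have -> : reconstruct @^-1` cylinder j0 c x =
    (reconstruct @^-1` cylinder j0 c x `&` trace_base) `|`
    (if `[< cylinder j0 c x T0 >] then ~` trace_base else set0).
  apply/seteqP; split => z /=.
    move=> cz; have [bz|nz] := pselect (trace_base z); [by left|right].
    by rewrite reconstructN // in cz; rewrite asboolT.
  case=> [[]//|]; case: asboolP => // cT nz.
  by rewrite reconstructN.
rewrite reconstruct_cylinder; apply: measurableU; last first.
  by case: ifP => // _; apply: measurableC; exact: measurable_trace_base.
apply: measurableX.
  apply: measurableI; first exact: measurable_trace_match.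
  exact: measurable_traceable.
by apply: measurableI; [exact: measurable_co|exact: measurable_lt].
Qed.

Local Notation P1 := (uniform_prob (@ltr01 R)).
Local Notation P2 := (uniform_prob l0).
Let P : probability _ R := (P1 \x P2)%E.

Definition reconstruct_mfun :
    {mfun (measurableTypeR R * measurableTypeR R)%type >-> X} :=
  HB.pack reconstruct (isMeasurableFun.Build _ _
    (measurableTypeR R * measurableTypeR R)%type X reconstruct
    measurable_reconstruct).

(** The law of the tiling rebuilt from a uniform odometer point and an
independent uniform phase. *)
Definition tiling_prob : probability X R := distribution P reconstruct_mfun.

Lemma P_trace_base : P trace_base = 1%E.
Proof.
rewrite /P /= product_measure1E; last 2 first.
- exact: measurable_traceable.
- exact: measurable_co.
rewrite [X in (X * _)%E](_ : _ = 1%E); last exact: measure_traceable.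
rewrite [X in (_ * X)%E](_ : _ = 1%E) ?mule1 //.
rewrite [LHS]uniform_prob_co //; last exact: ltW.
by rewrite !subr0 divff // lt0r_neq0.
Qed.

Lemma tiling_probE (A : set X) : measurable A ->
  tiling_prob A = P (reconstruct @^-1` A `&` trace_base).
Proof.
move=> mA; apply/esym; apply: probability_setI_full; last exact: P_trace_base.
  rewrite -[X in measurable X]setTI; exact: measurable_reconstruct.
exact: measurable_trace_base.
Qed.

Lemma measure_cylinder c x : 0 <= x <= lvl_len 0 ->
  tiling_prob (cylinder j0 c x) = (P1 (trace_match c) * (x / lvl_len 0)%:E)%E.
Proof.
move=> /andP[x0 xl]; rewrite tiling_probE; last exact: measurable_cylinder.
rewrite reconstruct_cylinder /P /=.
have -> : [set p : R | 0 <= p < lvl_len 0 /\ p < x] = [set p | 0 <= p < x].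
  apply/seteqP; split => p /=; first by move=> [/andP[-> _] ->].
  by move=> /andP[p0 px]; rewrite p0 px (lt_le_trans px).
rewrite product_measure1E; last 2 first.
- apply: measurableI; first exact: measurable_trace_match.
  exact: measurable_traceable.
- exact: measurable_co.
congr (_ * _)%E; last by rewrite [LHS]uniform_prob_co // !subr0.
apply: probability_setI_full; first exact: measurable_trace_match.
  exact: measurable_traceable.
exact: measure_traceable.
Qed.

Lemma hull_cell_shift (T : hull F 0) v k :
  hull_phase j0 (hull_shift (- v) T) = hull_phase j0 T + v - k%:~R * lvl_len 0
    ->
  forall d a, hull_cell j0 (hull_shift (- v) T) d a <-> hull_cell j0 T (d + k)
    a.
Proof.
move=> hk d a; rewrite /hull_cell /cell -/(hull_phase j0 _) -/(hull_phase j0 T)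
  hk /=.
rewrite /translate /= opprK.
suff -> : - (hull_phase j0 T + v - k%:~R * lvl_len 0) + d%:~R * lvl_len 0 + v =
  - hull_phase j0 T + (d + k)%:~R * lvl_len 0 by [].
by rewrite intrD; ring.
Qed.

(** After the translation by [v = w + k * lvl_len 0] the origin has crossed [k]
tile boundaries if [p + w < lvl_len 0] and [k + 1] otherwise; the two cases are
the two terms of the union. *)
Lemma shift_reconstruct_cylinder c x v (k : int) w : 0 <= x <= lvl_len 0 ->
  0 <= w < lvl_len 0 -> v = w + k%:~R * lvl_len 0 ->
  reconstruct @^-1` (hull_shift (- v) @^-1` cylinder j0 c x) `&` trace_base =
  ((trace_match (shift_constraints k c) `&` traceable) `*`
     [set p | 0 <= p < Num.max 0 (x - w)]) `|`
  ((trace_match (shift_constraints (k + 1) c) `&` traceable) `*`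
     [set p | lvl_len 0 - w <= p < Num.min (lvl_len 0) (lvl_len 0 - w + x)]).
Proof.
move=> /andP[x0 xl] /andP[w0 wl] vE.
have key (U p : R) (m : int) : trace_base (U, p) -> 0 <= p + v - m%:~R * lvl_len
  0 < lvl_len 0 ->
    cylinder j0 c x (hull_shift (- v) (reconstruct (U, p))) <->
    trace_match (shift_constraints m c) U /\ p + v - m%:~R * lvl_len 0 < x.
  move=> bz pm; have [/= h1 h2] := reconstructP bz.
  have hk : hull_phase j0 (hull_shift (- v) (reconstruct (U, p))) =
      p + v - m%:~R * lvl_len 0.
    have [z ze] := hull_phase_shift constF j0 (reconstruct (U, p) : hull F 0) v.
    rewrite h1 in ze; rewrite ze.
    have [/andP[q0 ql] _] :=
      hull_phaseP constF j0 (hull_shift (- v) (reconstruct (U, p))).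
    rewrite ze in q0 ql; move/andP: pm => [pm0 pml].
    have h3 : (z + m)%:~R < 1%:~R :> R.
      by rewrite -(ltr_pM2r l0) mul1r intrD mulrDl; lra.
    have h4 : (- 1)%:~R < (z + m)%:~R :> R.
      by rewrite -(ltr_pM2r l0) mulN1r intrD mulrDl; lra.
    have -> : z = - m by move: h3 h4; rewrite !ltr_int; lia.
    by rewrite intrN mulNr.
  have hs := hull_cell_shift (k := m) (T := reconstruct (U, p)) (v := v).
  rewrite h1 in hs; have {}hs := hs hk.
  rewrite /cylinder /= hk; split=> -[mt ->]; split => //.
    move=> _ /mapP[[d a] da ->] /=; apply/h2/hs.
    exact: mt _ da.
  move=> [d a] da /=; apply/hs/h2.
  by have := mt (d + m, a); apply; apply/mapP; exists (d, a).
apply/seteqP; split => -[U p] /=.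
  move=> [cz bz]; have [/= tU /andP[p0 pl]] := bz.
  have [pw|pw] := ltP (p + w) (lvl_len 0).
    have pm : 0 <= p + v - k%:~R * lvl_len 0 < lvl_len 0 by lra.
    left; have [mt px] := (key U p k bz pm).1 cz.
    by split => //; apply/andP; split => //; rewrite lt_max; apply/orP; right;
      lra.
  have pm : 0 <= p + v - (k + 1)%:~R * lvl_len 0 < lvl_len 0.
    by rewrite intrD mulrDl; lra.
  right; have [mt px] := (key U p (k + 1) bz pm).1 cz.
  split => //; rewrite intrD mulrDl in px.
  by apply/andP; split; [lra|rewrite lt_min; apply/andP; split; lra].
case=> [[[mt tU] /andP[p0]]|[[mt tU] /andP[p0]]].
  rewrite lt_max => /orP[|px]; first lra.
  have bz : trace_base (U, p) by split => //=; lra.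
  have pm : 0 <= p + v - k%:~R * lvl_len 0 < lvl_len 0 by lra.
  by split => //; apply/(key U p k bz pm); split => //; lra.
rewrite lt_min => /andP[pl px].
have bz : trace_base (U, p) by split => //=; lra.
have pm : 0 <= p + v - (k + 1)%:~R * lvl_len 0 < lvl_len 0.
  by rewrite intrD mulrDl; lra.
split => //; apply/(key U p (k + 1) bz pm); rewrite intrD mulrDl.
by split => //; lra.
Qed.

(** The lengths of the two ranges of the phase add up to [x], and by
stationarity the matching probability is the same for both. *)
Lemma measure_shift_cylinder c x v : 0 <= x <= lvl_len 0 ->
  tiling_prob (hull_shift (- v) @^-1` (cylinder j0 c x)) =
  tiling_prob (cylinder j0 c x).
Proof.
move=> xl; rewrite measure_cylinder //.
pose k := Num.floor (v / lvl_len 0); pose w := v - k%:~R * lvl_len 0.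
have wl : 0 <= w < lvl_len 0 by exact: floor_mod.
have vE : v = w + k%:~R * lvl_len 0 by rewrite /w subrK.
rewrite tiling_probE; last first.
  rewrite -[X in measurable X]setTI.
  exact: (measurable_hull_shift _ measurableT (measurable_cylinder constF j0 c
    x)).
rewrite (shift_reconstruct_cylinder c xl wl vE).
move/andP: (xl) (wl) => [x0 xl0] /andP[w0 wl0].
have mR c' a b : measurable ((trace_match c' `&` traceable) `*` [set p : R | a
  <= p < b]).
  apply: measurableX; last exact: measurable_co.
  by apply: measurableI;
    [exact: measurable_trace_match|exact: measurable_traceable].
rewrite measureU; [|exact: mR|exact: mR|]; last first.
  apply/seteqP; split => -[U p] //= [[_ /andP[p0]]].
  rewrite lt_max => /orP[px|px] [_ /andP[pw]]; first lra.
  by rewrite lt_min => /andP[pl pl']; lra.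
have E m a b : 0 <= a -> a <= b -> b <= lvl_len 0 ->
    P ((trace_match (shift_constraints m c) `&` traceable) `*` [set p : R | a <=
      p < b]) =
    (P1 (trace_match c) * ((b - a) / lvl_len 0)%:E)%E.
  move=> a0 ab bl; rewrite /P /= product_measure1E; last 2 first.
  - by apply: measurableI;
    [exact: measurable_trace_match|exact: measurable_traceable].
  - exact: measurable_co.
  congr (_ * _)%E; last by rewrite [LHS]uniform_prob_co // subr0.
  rewrite -(stationary constF unbounded m c).
  apply: probability_setI_full; first exact: measurable_trace_match.
    exact: measurable_traceable.
  exact: measure_traceable.
have sumE (a b a' b' : R) : 0 <= a -> a <= b -> b <= lvl_len 0 ->
    0 <= a' -> a' <= b' -> b' <= lvl_len 0 -> (b - a) + (b' - a') = x ->
    (P ((trace_match (shift_constraints k c) `&` traceable) `*`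
       [set p : R | (a <= p < b)%R]) +
     P ((trace_match (shift_constraints (k + 1) c) `&` traceable) `*`
       [set p : R | (a' <= p < b')%R]))%E =
    (P1 (trace_match c) * (x / lvl_len 0)%:E)%E.
  move=> a0 ab bl a'0 ab' bl' <-; rewrite !E // -ge0_muleDr.
  - by rewrite -EFinD -mulrDl.
  - by rewrite lee_fin divr_ge0 ?subr_ge0 // ltW.
  - by rewrite lee_fin divr_ge0 ?subr_ge0 // ltW.
have [xw|wx] := leP x w.
  have -> : Num.max 0 (x - w) = 0 by rewrite max_l //; lra.
  have -> : Num.min (lvl_len 0) (lvl_len 0 - w + x) = lvl_len 0 - w + x.
    by rewrite min_r //; lra.
  by apply: sumE; lra.
have -> : Num.max 0 (x - w) = x - w by rewrite max_r //; lra.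
have -> : Num.min (lvl_len 0) (lvl_len 0 - w + x) = lvl_len 0.
  by rewrite min_l //; lra.
by apply: sumE; lra.
Qed.

Lemma cylinder_clamp c x : exists2 x', 0 <= x' <= lvl_len 0 &
  cylinder j0 c x = cylinder j0 c x'.
Proof.
have ql (T : hull F 0) : 0 <= hull_phase j0 T < lvl_len 0.
  by have [] := hull_phaseP constF j0 T.
have l0' := l0; have [x0|x0] := ltP x 0.
  exists 0; first lra.
  by apply/seteqP; split => T [_ /= h]; have := ql T; lra.
have [xl|xl] := leP x (lvl_len 0); first by exists x => //; lra.
exists (lvl_len 0); first lra.
by apply/seteqP; split => T [h1 /= h2]; split => //=; have := ql T; lra.
Qed.

(** Two finite measures that agree on the cylinders, which are stable under
intersection and generate, are equal. *)
Lemma exists_invariant : exists mu : probability X R, translation_invariant mu.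
Proof.
exists tiling_prob => v A mA.
have mfv := measurable_hull_shift (F := F) v.
pose sh : {mfun X >-> X} :=
  HB.pack (hull_shift v : X -> X) (isMeasurableFun.Build _ _ X X (hull_shift v)
    mfv).
have cover : \bigcup_k cylinder j0 [::] k%:R = [set: X].
  apply/seteqP; split => // T _;
    exists (Num.trunc (hull_phase j0 (T : hull F 0))).+1 => //.
  by split; [move=> u|exact: truncnS_gt].
have cyl k : cylinders j0 (cylinder j0 [::] k%:R) by exists [::], k%:R.
have agree B : cylinders j0 B -> distribution tiling_prob sh B = tiling_prob B.
  move=> [c [x ->]]; have [x' x'l ->] := cylinder_clamp c x.
  by have := measure_shift_cylinder c (- v) x'l; rewrite opprK => <-.
have fin k : (distribution tiling_prob sh (cylinder j0 [::] k%:R) < +oo)%E.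
  apply: le_lt_trans (ltry 1); apply: probability_le1.
  exact: measurable_cylinder.
exact: (measure_unique _ _ (cylinders_generate constF j0) (cylindersI (j0 :=
  j0))
  cyl cover _ _ agree fin).
Qed.

End Existence.

(** * Unique ergodicity and pure point spectrum *)

Theorem theorem4p10 (R : realType) (F : fusion R) :
  primitive_fusion F ->
  recognizable F ->
  prototile_regular F ->
  constant_length F ->
  coincident_finite_waiting F ->
  bounded_transitions F ->
  uniquely_ergodic F /\
  (forall mu : probability (borel_tiling_space F) R,
     translation_invariant mu -> pure_point_spectrum mu).
Proof.
move=> _ recF regF constF [k coinF] [C boundC].
have [G liftG] := supertile_lift recF.
have [T0 _] := fusion_nonempty F.
have typeP N : exists j : 'I_(ntypes F N), True.
  have [cov _] := hull_tiling (G N T0).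
  have : [set: R] 0 by [].
  by rewrite -cov => -[[x j] _ _]; exists j.
pose j0 N := projT1 (cid (typeP N)).
have unb := lvl_size_unbounded constF j0 T0.
have coincF : mostly_coincident j0.
  move=> d e e0.
  have [N NP] := window_coincident_small constF regF boundC coinF d e0 unb.
  by exists N; exact: NP.
split; last by move=> mu mu_inv; exact: (pure_point constF liftG coincF mu_inv).
have [mu mu_inv] := exists_invariant constF coincF unb.
exists mu; split => // nu nu_inv.
exact: (invariant_unique constF liftG coincF mu_inv nu_inv).
Qed.
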